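(* For any integer $d\ge 1$ and any complex numbers $z_0,z_1,\ldots,z_{2d}$ with $|z_j|<1$, $j=0,1,\ldots,2d$, we have $$\sum_{a_0,\ldots,a_{2d}\ge 0}\zeta^{\star}(\{2\}^{a_0},3,\{2\}^{a_1},1,\ldots,3,\{2\}^{a_{2d-1}},1,\{2\}^{a_{2d}})\,z_0^{2a_0}\cdots z_{2d}^{2a_{2d}}=-\sum_{k_0\ge\cdots\ge k_{2d}\ge 1}k_{2d}^2\,\prod_{i=0}^{2d}\frac{(-1)^{k_i}\cdot 2^{\Delta(k_{i-1},k_i)}}{k_i^2-z_i^2},$$ where $k_{-1}=0$, and $$\sum_{a_1,\ldots,a_{2d}\ge 0}\zeta^{\star}(\{2\}^{a_1},3,\{2\}^{a_2},1,\ldots,3,\{2\}^{a_{2d}},1)\,z_1^{2a_1}\cdots z_{2d}^{2a_{2d}}=\sum_{k_1\ge\cdots\ge k_{2d}\ge 1}\,\prod_{i=1}^{2d}\frac{(-1)^{k_i}\cdot 2^{\Delta(k_{i-1},k_i)}}{k_i^2-z_i^2},$$ where $k_0=0$. In both formulas the entries separating the blocks of twos alternate $3,1,3,1,\ldots,3,1$ ($d$ threes and $d$ ones); in the second formula the last entry $1$ ends the argument string.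
   Context: For positive integers $s_1,\ldots,s_m$ with $s_1\ge 2$, the multiple zeta star value is $\zeta^\star(s_1,\ldots,s_m)=\sum_{k_1\ge\cdots\ge k_m\ge 1}\frac{1}{k_1^{s_1}\cdots k_m^{s_m}}$ (sum over positive integers), and $\zeta^\star(\emptyset)=1$. $\{2\}^a$ denotes the sequence consisting of $a$ copies of $2$ (empty if $a=0$). $\Delta(a,b)=0$ if $a=b$ and $\Delta(a,b)=1$ otherwise. In all sums the indices $a_i,k_i$ are integers, and $0^0=1$ in power series. *)

(* Defs.v *)
From HB Require Import structures.
From mathcomp Require Import all_boot all_order all_algebra.
From mathcomp Require Import finmap.
From mathcomp Require Import boolp classical_sets reals ereal esum.
From mathcomp Require Import complex.

Set Implicit Arguments.
Unset Strict Implicit.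
Unset Printing Implicit Defensive.

Import Order.TTheory GRing.Theory Num.Theory.

Local Open Scope classical_set_scope.
Local Open Scope ring_scope.

(* Unconditional convergence: the finite partial sums, directed by inclusion,
   tend to S. For real or complex terms this is the same as absolute
   convergence, so no order of summation has to be chosen. *)
Definition has_sum (K : numFieldType) (I : choiceType) (D : set I)
    (f : I -> K) (S : K) : Prop :=
  forall e : K, 0 < e ->
    exists2 A : {fset I}, [set` A] `<=` D &
      forall B : {fset I}, (A `<=` B)%fset -> [set` B] `<=` D ->
        `|\sum_(i <- B) f i - S| < e.

Definition decr_tuples (n : nat) : set (n.-tuple nat) :=
  [set k | sorted geq k && all (leq 1) k].
Arguments decr_tuples n : clear implicits.

(* All terms are nonnegative, so the sum is taken in \bar R; it is finite as
   soon as s is empty or has positive entries with the first at least 2, and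
   [fine] is then the identity. The empty string gives an empty product, i.e.
   the value 1. *)
Definition zeta_star (R : realType) (s : seq nat) : R :=
  fine (\esum_(k in decr_tuples (size s))
    ((\prod_(i < size s) ((tnth k i)%:R ^+ nth 0%N s i)^-1 : R)%:E)).

(* {2}^{a 0}, 3, {2}^{a 1}, 1, {2}^{a 2}, 3, ... with n blocks, each one
   followed by its separator. *)
Definition blocks31 (n : nat) (a : nat -> nat) : seq nat :=
  flatten [seq rcons (nseq (a j) 2%N) (if odd j then 1%N else 3%N)
          | j <- iota 0 n].

Definition Delta (a b : nat) : nat := if a == b then 0%N else 1%N.

(* [nth 0 (0 :: k) i] is the entry preceding the i-th one, with the convention
   that the entry preceding the first one is 0. *)
Definition alt_prod (R : realType) (n : nat) (z : 'I_n -> R[i])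
    (k : n.-tuple nat) : R[i] :=
  \prod_(i < n)
    ((-1) ^+ tnth k i * 2 ^+ Delta (nth 0%N (0%N :: k) i) (tnth k i)
     / ((tnth k i)%:R ^+ 2 - z i ^+ 2)).

(* Main.v *)
Require Import Defs.
From HB Require Import structures.
From mathcomp Require Import all_boot all_order all_algebra.
From mathcomp Require Import finmap.
From mathcomp Require Import boolp classical_sets functions cardinality fsbigop.
From mathcomp Require Import reals ereal esum.
From mathcomp Require Import complex.
From mathcomp Require Import ring.

(** Truncate everything at [n]: let [Z_n s] be the zeta star sum restricted to
    [k_1 <= n], and let [A_n] be the generating function of the numbers [Z_n]
    over all strings of one of the two given shapes.  Splitting off the terms
    with [k_1 = n] shows that, if [B_n] is the generating function of what
    follows the first block and its separator [e],

      [(1 - z^2 / n^2) A_n = A_(n-1) + B_n / n^e].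

    Write [c_n(k) = binom(n, k) / binom(n + k, k)].  Since
    [n^2 c_(n-1)(k) = (n^2 - k^2) c_n(k)], this recurrence is diagonal in the
    functions [n |-> c_n(k)]: if [n^2 B_n / n^e = sum_k c_n(k) w_k], then
    [A_n = sum_k c_n(k) w_k / (k^2 - z^2)]  ([gf_step_solve]).  It remains to
    know what multiplication and division by [n] do to such expansions.  Both
    follow from the single relation

      [n (c_n(k) - c_n(k+1)) = k c_n(k) + (k+1) c_n(k+1)],

    telescoped without or with alternating signs, and in both cases the new
    coefficient at [l] is, up to the explicit factors [l] and [(-1)^l],
    [sum_(k <= l) 2^Delta(l,k) v_k]  ([psum_mul_Delta_sum],
    [psum_sign_Delta_sum]).  A separator 1 asks for a multiplication by [n] and
    a separator 3 for a division, so along the alternating string 3, 1, 3, 1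
    the factors [k (-1)^k] appear and disappear again ([bin_rep_step]).  The
    last block of twos contributes [prod_(k <= n) (1 - z^2/k^2)^-1], whose
    expansion is classical ([bin_rep_twos]); if the string ends with a
    separator, one starts from the constant 1 ([bin_rep_one]).

    Iterating, one obtains for every [n >= 1] the identity

      [A_n = +- sum_(n >= k_0 >= k_1 >= ...) c_n(k_0) * (term of the theorem)]

    ([bin_rep_word_gf_open], [bin_rep_word_gf_closed]).  Now [n] goes to
    infinity: [0 <= c_n(k) <= 1] and [c_n(k)] tends to 1, and [Z_n s] increases
    to the zeta star value, so a dominated convergence theorem for
    unconditional sums ([dominated_has_sum]) applies on both sides.  The terms
    on the right are absolutely summable because each inner sum is
    [O(harmonic number)] ([abs_chain_sum_open], [abs_chain_sum_closed]).  The
    left side needs no estimate of its own: applied to the nonnegative numbers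
    [|z_j|], the finite identity bounds the nonnegative left side by the
    absolute sum of the right side.

    Sequences of indices are handled as lists, which suit recursion on the
    number of blocks; the passage to tuples comes last. *)

Set Implicit Arguments.
Unset Strict Implicit.
Unset Printing Implicit Defensive.

Import Order.TTheory GRing.Theory Num.Theory.

Local Open Scope classical_set_scope.
Local Open Scope ring_scope.
Local Open Scope complex_scope.

(** * Unconditional sums *)

Definition abs_bounded (K : numFieldType) (I : choiceType) (D : set I)
    (f : I -> K) (M : K) : Prop :=
  forall B : {fset I}, [set` B] `<=` D -> \sum_(i <- B) `|f i| <= M.

(** The bound is carried along with the sum: it is what guarantees that a
    geometrically transformed family is summable again. *)
Definition abs_has_sum (K : numFieldType) (I : choiceType) (D : set I)
    (f : I -> K) (S : K) : Prop :=
  has_sum D f S /\ exists M, abs_bounded D f M.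

Lemma fset_sumID (K : numFieldType) (I : choiceType) (A B : {fset I})
    (f : I -> K) : (A `<=` B)%fset ->
  \sum_(i <- B) f i = \sum_(i <- A) f i + \sum_(i <- (B `\` A)%fset) f i.
Proof.
move=> AB; rewrite (big_fsetID _ (mem A)) /=; congr (_ + _).
  apply: eq_fbigl => i; rewrite !inE /=.
  by case: (boolP (i \in A)) => [/(fsubsetP AB) -> //|_]; rewrite andbF.
by apply: eq_fbigl => i; rewrite !inE /= andbC.
Qed.

Lemma fset_sum_mono (K : numFieldType) (I : choiceType) (D : set I)
    (A B : {fset I}) (f : I -> K) :
  (forall i, D i -> 0 <= f i) -> (A `<=` B)%fset -> [set` B] `<=` D ->
  \sum_(i <- A) f i <= \sum_(i <- B) f i.
Proof.
move=> f0 AB BD; rewrite (fset_sumID _ AB) lerDl big_seq sumr_ge0 // => i.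
by rewrite inE => /andP[_ iB]; apply/f0/BD.
Qed.

Lemma fset_subU (I : choiceType) (D : set I) (A B : {fset I}) :
  [set` A] `<=` D -> [set` B] `<=` D -> [set` (A `|` B)%fset] `<=` D.
Proof. by move=> AD BD i /=; rewrite inE => /orP[/AD|/BD]. Qed.

(** The norm stands for [S] because realness of [S] would need a limit argument
    of its own in an ordered field that may be complex. *)
Lemma has_sum_ge0_le (K : numFieldType) (I : choiceType) (D : set I)
    (f : I -> K) (S : K) (B : {fset I}) :
  (forall i, D i -> 0 <= f i) -> has_sum D f S ->
  [set` B] `<=` D -> \sum_(i <- B) f i <= `|S|.
Proof.
move=> f0 fS BD.
have sum_ge0 (A : {fset I}) : [set` A] `<=` D -> 0 <= \sum_(i <- A) f i.
  by move=> AD; rewrite big_seq sumr_ge0 // => i iA; exact/f0/AD.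
rewrite real_leNgt ?normr_real ?ger0_real ?sum_ge0 //; apply/negP => SB.
have [A AD AP] := fS (\sum_(i <- B) f i - `|S|) (etrans (subr_gt0 _ _) SB).
have UD := fset_subU AD BD.
have le := fset_sum_mono f0 (fsubsetUr A B) UD.
have := le_lt_trans (lerB_dist _ _) (AP _ (fsubsetUl A B) UD).
rewrite ger0_norm ?sum_ge0 // ltrD2r => /(le_lt_trans le).
by rewrite ltxx.
Qed.

Lemma has_sum_lin (K : numFieldType) (I : choiceType) (D : set I)
    (f g : I -> K) (S T c : K) :
  has_sum D f S -> has_sum D g T ->
  has_sum D (fun i => f i + c * g i) (S + c * T).
Proof.
move=> fS gT e e0.
have c0 : 0 < 1 + `|c| by rewrite ltr_pwDl.
have e'0 : 0 < e / 2%:R / (1 + `|c|) by rewrite !divr_gt0.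
have [A AD AP] := fS (e / 2%:R) (divr_gt0 e0 (ltr0n _ 2)).
have [A' AD' AP'] := gT _ e'0.
exists (A `|` A')%fset; first exact: fset_subU.
move=> B /fsubUsetP[AB AB'] BD.
rewrite big_split /= -mulr_sumr opprD addrACA -mulrBr.
apply: le_lt_trans (ler_normD _ _) _.
rewrite [ltRHS](splitr e) ltr_leD //; first exact: AP.
have := ltW (AP' B AB' BD); rewrite normrM ler_pdivlMr // mulrC.
by apply: le_trans; rewrite ler_wpM2r // lerDr.
Qed.

Lemma abs_bounded_lin (K : numFieldType) (I : choiceType) (D : set I)
    (f g : I -> K) (M N c : K) :
  abs_bounded D f M -> abs_bounded D g N ->
  abs_bounded D (fun i => f i + c * g i) (M + `|c| * N).
Proof.
move=> fM gN B BD.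
apply: (@le_trans _ _ (\sum_(i <- B) (`|f i| + `|c| * `|g i|))).
  by apply: ler_sum => i _; rewrite -normrM ler_normD.
rewrite big_split /= -mulr_sumr lerD ?fM //.
by rewrite ler_wpM2l // gN.
Qed.

Lemma abs_has_sum_lin (K : numFieldType) (I : choiceType) (D : set I)
    (f g : I -> K) (S T c : K) :
  abs_has_sum D f S -> abs_has_sum D g T ->
  abs_has_sum D (fun i => f i + c * g i) (S + c * T).
Proof.
move=> [fS [M fM]] [gT [N gN]]; split; first exact: has_sum_lin.
by exists (M + `|c| * N); exact: abs_bounded_lin.
Qed.

Lemma eq_has_sum (K : numFieldType) (I : choiceType) (D : set I)
    (f g : I -> K) (S : K) :
  (forall i, D i -> f i = g i) -> has_sum D f S -> has_sum D g S.
Proof.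
move=> fg fS e /fS[A AD AP]; exists A => // B AB BD.
have <- : \sum_(i <- B) f i = \sum_(i <- B) g i; last exact: AP.
by rewrite big_seq [RHS]big_seq; apply: eq_bigr => i /BD /fg.
Qed.

Lemma eq_abs_bounded (K : numFieldType) (I : choiceType) (D : set I)
    (f g : I -> K) (M : K) :
  (forall i, D i -> f i = g i) -> abs_bounded D f M -> abs_bounded D g M.
Proof.
move=> fg fM B BD; apply: le_trans (fM _ BD).
by rewrite big_seq [leRHS]big_seq; apply: ler_sum => i /BD /fg ->.
Qed.

Lemma eq_abs_has_sum (K : numFieldType) (I : choiceType) (D : set I)
    (f g : I -> K) (S : K) :
  (forall i, D i -> f i = g i) -> abs_has_sum D f S -> abs_has_sum D g S.
Proof.
move=> fg [fS [M fM]]; split; first exact: eq_has_sum fS.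
by exists M; exact: eq_abs_bounded fM.
Qed.

Lemma has_sum_unique (K : numFieldType) (I : choiceType) (D : set I)
    (f : I -> K) (S T : K) : has_sum D f S -> has_sum D f T -> S = T.
Proof.
move=> fS fT; apply/eqP; rewrite -subr_eq0 -normr_eq0; apply/negPn/negP => n0.
have e0 : 0 < `|S - T| / 2%:R by rewrite divr_gt0 // lt_def n0 normr_ge0.
have [A AD AP] := fS _ e0; have [A' AD' AP'] := fT _ e0.
have UD := fset_subU AD AD'.
have := ltrD (AP _ (fsubsetUl _ _) UD) (AP' _ (fsubsetUr _ _) UD).
rewrite -splitr distrC => /(le_lt_trans (ler_normD _ _)).
by rewrite addrA subrK ltxx.
Qed.

(** The inverse image of [B] under [h : D' -> I], computed from a partial
    inverse [k] of [h]. *)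
Definition fset_pull (I J : choiceType) (D' : set J) (h : J -> I) (k : I -> J)
    (B : {fset I}) : {fset J} :=
  [fset k i | i in B & `[< D' (k i) >] && (h (k i) == i)]%fset.

Lemma fset_pullP (K : numFieldType) (I J : choiceType) (D' : set J) (D : set I)
    (h : J -> I) (k : I -> J) (f : I -> K) (B : {fset I}) :
  (forall i, D i -> ~ (D' (k i) /\ h (k i) = i) -> f i = 0) ->
  [set` B] `<=` D ->
  \sum_(j <- fset_pull D' h k B) f (h j) = \sum_(i <- B) f i.
Proof.
move=> f0 BD; rewrite big_imfset /=; last first.
  by move=> i j /and3P[_ _ /eqP hi] /and3P[_ _ /eqP hj] e; rewrite -hi -hj e.
rewrite big_filter [RHS](bigID (fun i => `[< D' (k i) >] && (h (k i) == i))) /=.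
rewrite [X in _ = _ + X]big_seq_cond [X in _ = _ + X]big1 ?addr0; last first.
  move=> i /andP[/BD Di ni]; apply: f0 => // -[Dk hk].
  by move: ni; rewrite hk eqxx andbT; case: asboolP.
by apply: eq_bigr => i /andP[_ /eqP ->].
Qed.

Lemma fset_pull_sub (I J : choiceType) (D' : set J)
    (h : J -> I) (k : I -> J) (B : {fset I}) :
  [set` fset_pull D' h k B] `<=` D'.
Proof.
by move=> j /= /imfsetP[i /=]; rewrite !inE => /andP[_ /andP[/asboolP Dk _]] ->.
Qed.

(** Covers both a bijection of index sets and the extension of a family by zero,
    according to whether [h] maps [D'] onto [D] or not. *)
Lemma has_sum_reindex (K : numFieldType) (I J : choiceType) (D' : set J)
    (D : set I) (h : J -> I) (k : I -> J) (f : I -> K) (S : K) :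
  (forall j, D' j -> D (h j) /\ k (h j) = j) ->
  (forall i, D i -> ~ (D' (k i) /\ h (k i) = i) -> f i = 0) ->
  has_sum D' (fun j => f (h j)) S -> has_sum D f S.
Proof.
move=> hk f0 fS e /fS[A AD AP]; exists (h @` A)%fset.
  by move=> i /= /imfsetP[j /= jA ->]; have [] := hk j (AD _ jA).
move=> B AB BD; rewrite -(fset_pullP f0 BD).
apply: AP; last exact: fset_pull_sub.
apply/fsubsetP => j jA; have [Dh kh] := hk j (AD _ jA).
apply/imfsetP; exists (h j); rewrite ?kh // !inE kh eqxx andbT.
rewrite (fsubsetP AB) /=; last by apply/imfsetP; exists j.
by apply/asboolP/AD.
Qed.

Lemma abs_has_sum_reindex (K : numFieldType) (I J : choiceType) (D' : set J)
    (D : set I) (h : J -> I) (k : I -> J) (f : I -> K) (S : K) :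
  (forall j, D' j -> D (h j) /\ k (h j) = j) ->
  (forall i, D i -> ~ (D' (k i) /\ h (k i) = i) -> f i = 0) ->
  abs_has_sum D' (fun j => f (h j)) S -> abs_has_sum D f S.
Proof.
move=> hk f0 [fS [M fM]]; split; first exact: (has_sum_reindex hk f0).
exists M => B BD.
have f0' i : D i -> ~ (D' (k i) /\ h (k i) = i) -> `|f i| = 0.
  by move=> Di ni; rewrite f0 ?normr0.
by rewrite -(fset_pullP f0' BD); apply: fM; exact: fset_pull_sub.
Qed.

Lemma abs_has_sum_finite (K : numFieldType) (I : choiceType) (D : set I)
    (s : seq I) (f : I -> K) :
  uniq s -> [set` s] `<=` D -> (forall i, D i -> i \notin s -> f i = 0) ->
  abs_has_sum D f (\sum_(i <- s) f i).
Proof.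
move=> us sD f0; set A : {fset I} := [fset i in s]%fset.
have sA (g : I -> K) : \sum_(i <- A) g i = \sum_(i <- s) g i.
  by apply/perm_big/uniq_perm => //= i; rewrite !inE.
have key (g : I -> K) B : (A `<=` B)%fset -> [set` B] `<=` D ->
    (forall i, D i -> i \notin s -> g i = 0) ->
    \sum_(i <- B) g i = \sum_(i <- s) g i.
  move=> AB BD g0; rewrite -sA; apply/esym/big_fset_incl => // i /BD Di.
  by rewrite !inE => /(g0 _ Di).
have AD : [set` A] `<=` D by move=> i /=; rewrite !inE => /sD.
split.
  move=> e e0; exists A => // B AB BD.
  by rewrite key // subrr normr0.
exists (\sum_(i <- s) `|f i|) => B BD.
rewrite -(key (fun i => `|f i|) (A `|` B)%fset) ?fsubsetUl //; last first.
- by move=> i Di /(f0 _ Di) ->; rewrite normr0.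
- exact: fset_subU.
apply: (fset_sum_mono (D := D)) => //; first exact: fsubsetUr.
exact: fset_subU.
Qed.

Lemma sum_fset_le_seq (K : numFieldType) (I : choiceType) (B : {fset I})
    (s : seq I) (f : I -> K) : uniq s -> (forall i, 0 <= f i) ->
  {subset B <= s} -> \sum_(i <- B) f i <= \sum_(i <- s) f i.
Proof.
move=> us f0 Bs.
have -> : \sum_(i <- s) f i = \sum_(i <- [fset i in s]%fset) f i.
  by apply/perm_big/uniq_perm => //= i; rewrite !inE.
apply: (fset_sum_mono (D := setT)) => //.
by apply/fsubsetP => i /Bs; rewrite !inE.
Qed.

Lemma norm_real_complex (R : rcfType) (x : R) : `|x%:C| = `|x|%:C.
Proof. by rewrite normc_def /= expr0n addr0 sqrtr_sqr. Qed.

(** * Existence of sums and dominated convergence *)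

Lemma ge0_has_sum (R : realType) (I : choiceType) (D : set I) (g : I -> R)
    (M : R) : (forall i, D i -> 0 <= g i) ->
  (forall B : {fset I}, [set` B] `<=` D -> \sum_(i <- B) g i <= M) ->
  exists S, has_sum D g S.
Proof.
move=> g0 gM.
pose E := [set x : R | exists2 B : {fset I}, [set` B] `<=` D
                                          & x = \sum_(i <- B) g i].
have hsE : has_sup E.
  split; last by exists M => _ [B BD ->]; exact: gM.
  by exists (\sum_(i <- fset0) g i); exists fset0.
exists (sup E) => e e0.
have [_ [A AD ->] Ae] := sup_adherent e0 hsE.
exists A => // B AB BD.
have le : \sum_(i <- B) g i <= sup E by apply: ub_le_sup; [case: hsE | exists B].
have AleB := fset_sum_mono g0 AB BD.
rewrite ler0_norm ?subr_le0 // opprB ltrBlDl -ltrBlDr.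
exact: lt_le_trans Ae AleB.
Qed.

(** [Re f] is the difference of the nonnegative families [Re f + |f|] and
    [|f|], both with bounded partial sums. *)
Lemma abs_bounded_has_sum_Re (R : realType) (I : choiceType) (D : set I)
    (f : I -> R[i]) (M : R[i]) : abs_bounded D f M ->
  exists S, has_sum D (fun i => (complex.Re (f i))%:C) S.
Proof.
move=> fM; pose n i := complex.Re `|f i|.
have nE i : (n i)%:C = `|f i| by rewrite RRe_real // normr_real.
have abs_n i : `|complex.Re (f i)| <= n i by rewrite -lecR nE normc_ge_Re.
have n0 i : 0 <= n i by apply: le_trans (abs_n i); rewrite normr_ge0.
have nM (B : {fset I}) : [set` B] `<=` D -> \sum_(i <- B) n i <= complex.Re M.
  move=> /(fM B); under eq_bigr do rewrite -nE.
  by rewrite -rmorph_sum /= lecE /= => /andP[_].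
have [S2 nS] := @ge0_has_sum R I D n _ (fun i _ => n0 i) nM.
have [||S1 gS] := @ge0_has_sum R I D (fun i => complex.Re (f i) + n i)
   (complex.Re M + complex.Re M).
- by move=> i _; have := abs_n i; rewrite ler_norml -subr_ge0 opprK addrC => /andP[].
- move=> B BD; apply: le_trans (lerD (nM _ BD) (nM _ BD)).
  rewrite -big_split; apply: ler_sum => i _; rewrite lerD2r.
  exact: le_trans (ler_norm _) (abs_n i).
have := has_sum_lin (-1) gS nS.
move=> h; exists (S1 + -1 * S2)%:C => e e0.
have er : e = (complex.Re e)%:C by rewrite RRe_real // gtr0_real.
rewrite er in e0 *; rewrite ltcR in e0.
have [A AD AP] := h _ e0; exists A => // B AB BD.
rewrite /= -rmorph_sum -rmorphB norm_real_complex ltcR.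
suff -> : \sum_(i <- B) complex.Re (f i) =
  \sum_(i <- B) (complex.Re (f i) + n i + -1 * n i) by exact: AP.
by apply: eq_bigr => i _; rewrite mulN1r addrK.
Qed.

Lemma abs_bounded_has_sum (R : realType) (I : choiceType) (D : set I)
    (f : I -> R[i]) (M : R[i]) : abs_bounded D f M -> exists S, has_sum D f S.
Proof.
move=> fM; have [S1 h1] := abs_bounded_has_sum_Re fM.
have fM' : abs_bounded D (fun i => 'i%C * f i) M.
  move=> B /(fM B); congr (_ <= _); apply: eq_bigr => i _.
  by rewrite normrM (normc_def 'i%C) /= expr0n add0r expr1n sqrtr1 mul1r.
have [S2 h2] := abs_bounded_has_sum_Re fM'.
exists (S1 + (- 'i%C) * S2); apply: eq_has_sum (has_sum_lin _ h1 h2) => i _ /=.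
by case: (f i) => a b; simpc.
Qed.

Definition tends_to (K : numFieldType) (u : nat -> K) (l : K) : Prop :=
  forall e, 0 < e -> exists N, forall n, (N <= n)%N -> `|u n - l| < e.

Lemma tends_to_unique (K : numFieldType) (u : nat -> K) (l l' : K) :
  tends_to u l -> tends_to u l' -> l = l'.
Proof.
move=> ul ul'; apply/eqP; rewrite -subr_eq0 -normr_eq0; apply/negPn/negP => n0.
have e0 : 0 < `|l - l'| / 2%:R by rewrite divr_gt0 // lt_def n0 normr_ge0.
have [N uN] := ul _ e0; have [N' uN'] := ul' _ e0.
have := ltrD (uN _ (leq_maxl N N')) (uN' _ (leq_maxr N N')).
rewrite -splitr distrC => /(le_lt_trans (ler_normD _ _)).
by rewrite addrA subrK ltxx.
Qed.

Lemma tends_to_seq (K : numFieldType) (I : eqType) (s : seq I)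
    (u : nat -> I -> K) (l : I -> K) :
  (forall i, i \in s -> tends_to (fun n => u n i) (l i)) ->
  forall e, 0 < e ->
  exists N, forall n, (N <= n)%N -> \sum_(i <- s) `|u n i - l i| < e.
Proof.
elim: s => [|i s IHs] ul e e0.
  by exists 0%N => n _; rewrite big_nil.
have e2 : 0 < e / 2%:R by rewrite divr_gt0.
have [N uN] := ul i (mem_head _ _) _ e2.
have [j js|N' uN'] := IHs _ _ e2; first by apply: ul; rewrite inE js orbT.
exists (maxn N N') => n; rewrite geq_max => /andP[nN nN'].
by rewrite big_cons [e]splitr ltrD ?uN ?uN'.
Qed.

(** Tannery's theorem: outside a finite set the majorant [g] has small sums,
    uniformly in [n], and on that finite set termwise convergence is uniform. *)
Lemma dominated_has_sum (R : realType) (I : choiceType) (D : set I)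
    (u : nat -> I -> R[i]) (f g : I -> R[i]) (A : nat -> R[i]) (M : R[i]) :
  (forall n i, D i -> `|u n i| <= g i) -> (forall i, D i -> `|f i| <= g i) ->
  abs_bounded D g M -> (forall i, D i -> tends_to (fun n => u n i) (f i)) ->
  (forall n, has_sum D (u n) (A n)) ->
  exists S, has_sum D f S /\ tends_to A S.
Proof.
move=> ug fg gM uf uA.
have g0 i : D i -> 0 <= g i by move=> /fg; apply: le_trans.
have fM : abs_bounded D f M.
  move=> B BD; apply: le_trans (gM _ BD).
  rewrite big_seq [leRHS]big_seq; apply: ler_sum => i /BD Di.
  by rewrite (ger0_norm (g0 _ Di)) fg.
have [S fS] := abs_bounded_has_sum fM.
have [G gG] := abs_bounded_has_sum gM.
exists S; split=> // e e0.
(* One e' for A n, one for S, one for the terms inside A1, and 2 * (e' + e') for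
   the terms outside A1. *)
pose e' := e / 7%:R.
have e'0 : 0 < e' by rewrite divr_gt0.
have [A1 A1D A1P] := gG _ e'0.
have [i iA1|N uN] := @tends_to_seq _ _ A1 u f _ _ e'0; first exact/uf/A1D.
exists N => n /uN le1.
have [A2 A2D A2P] := uA n _ e'0.
have [A3 A3D A3P] := fS _ e'0.
pose B := (A1 `|` (A2 `|` A3))%fset.
have BD : [set` B] `<=` D by apply: fset_subU => //; exact: fset_subU.
have A1B : (A1 `<=` B)%fset by exact: fsubsetUl.
have A2B : (A2 `<=` B)%fset by rewrite fsubsetU // fsubsetUl orbT.
have A3B : (A3 `<=` B)%fset by rewrite fsubsetU // fsubsetUr orbT.
have le2 := A2P B A2B BD; have le3 := A3P B A3B BD.
have tail : \sum_(i <- (B `\` A1)%fset) g i < e' + e'.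
  have tE : \sum_(i <- (B `\` A1)%fset) g i =
            (\sum_(i <- B) g i - G) - (\sum_(i <- A1) g i - G).
    by rewrite (fset_sumID _ A1B); ring.
  have h : \sum_(i <- (B `\` A1)%fset) g i \is Num.real.
    rewrite big_seq sum_real // => i; rewrite inE => /andP[_ iB].
    exact/ger0_real/g0/BD.
  apply: le_lt_trans (real_ler_norm h) _; rewrite tE.
  apply: le_lt_trans (ler_normB _ _) _; apply: ltrD; first exact: A1P.
  exact: A1P.
have mid : `|\sum_(i <- B) u n i - \sum_(i <- B) f i| < e' + (e' + e') * 2%:R.
  rewrite -sumrB; apply: le_lt_trans (ler_norm_sum _ _ _) _.
  rewrite (fset_sumID _ A1B); apply: ltr_leD => //.
  apply: (@le_trans _ _ (\sum_(i <- (B `\` A1)%fset) g i * 2%:R)).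
    rewrite big_seq [leRHS]big_seq; apply: ler_sum => i.
    rewrite inE => /andP[_ /BD Di].
    by rewrite mulr_natr mulr2n (le_trans (ler_normB _ _)) // lerD ?ug ?fg.
  by rewrite -mulr_suml ler_wpM2r // ltW.
have -> : A n - S = - (\sum_(i <- B) u n i - A n) +
   ((\sum_(i <- B) u n i - \sum_(i <- B) f i) + (\sum_(i <- B) f i - S)) by ring.
have -> : e = e' + ((e' + (e' + e') * 2%:R) + e') by rewrite /e'; field.
apply: le_lt_trans (ler_normD _ _) _; rewrite normrN; apply: ltrD => //.
by apply: le_lt_trans (ler_normD _ _) _; apply: ltrD.
Qed.

(** * Generating functions with respect to one exponent *)

Definition sized (m : nat) : set (seq nat) := [set a | size a = m].

(** In the first entry of the index, [X] is the convolution of [V] with the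
    powers of [q].  The relation between [X] and [V] reads [X = V + q Y] with
    [Y] the shift of [X]; as [X] and [Y] have the same sum, that sum is
    [v / (1 - q)] as soon as it exists.  Existence follows from a bound on the
    sums of [|X|], obtained from the same relation by induction on the largest
    first entry. *)
Lemma abs_has_sum_geom (R : realType) (m : nat) (X V : seq nat -> R[i])
    (q v : R[i]) : `|q| < 1 ->
  (forall a, size a = m -> X (0%N :: a) = V (0%N :: a)) ->
  (forall n a, size a = m -> X (n.+1 :: a) = V (n.+1 :: a) + q * X (n :: a)) ->
  abs_has_sum (sized m.+1) V v -> abs_has_sum (sized m.+1) X (v / (1 - q)).
Proof.
move=> q1 X0 XS hV.
(* h is the shift of the first entry, k its partial inverse. *)
pose h a := ((head 0 a).+1 :: behead a)%N.
pose k a := ((head 0 a).-1 :: behead a)%N.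
pose Y a := if a is n.+1 :: a' then X (n :: a') else 0.
have XE a : sized m.+1 a -> X a = V a + q * Y a.
  case: a => [//|[|n] a] [sa] /=; first by rewrite X0 // mulr0 addr0.
  by rewrite XS.
have Yh a : sized m.+1 a -> Y (h a) = X a by case: a.
have hk a : sized m.+1 a -> sized m.+1 (h a) /\ k (h a) = a.
  by case: a => //= n a [sa]; rewrite /sized /= sa.
have Y0 a : sized m.+1 a -> ~ (sized m.+1 (k a) /\ h (k a) = a) -> Y a = 0.
  by case: a => [//|[//|n] a] sa []; rewrite /k /h.
have [_ [M VM]] := hV.
have q0 : 0 < 1 - `|q| by rewrite subr_gt0.
have M0 : 0 <= M by have := VM fset0; rewrite big_seq_fset0; apply.
have bX : abs_bounded (sized m.+1) X (M / (1 - `|q|)).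
  (* N bounds the first entries of the members of B. *)
  suff H N : forall B : {fset seq nat}, [set` B] `<=` sized m.+1 ->
      (forall a, a \in B -> (head 0 a < N)%N) ->
      \sum_(a <- B) `|X a| <= M / (1 - `|q|).
    move=> B BD; apply: (H (\max_(a <- B) (head 0 a).+1)%N) => // a aB.
    by apply: (@leq_bigmax_seq _ _ predT (fun a => (head 0 a).+1)%N).
  elim: N => [|N IHN] B BD BN.
    rewrite big_seq big1 ?divr_ge0 // ?(ltW q0) // => a /BN.
    by rewrite ltn0.
  have -> : M / (1 - `|q|) = M + `|q| * (M / (1 - `|q|)).
    by field; rewrite gt_eqF.
  apply: (@le_trans _ _ (\sum_(a <- B) (`|V a| + `|q| * `|Y a|))).
    rewrite big_seq [leRHS]big_seq; apply: ler_sum => a /BD /XE ->.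
    by rewrite -normrM ler_normD.
  rewrite big_split /= -mulr_sumr lerD ?VM // ler_wpM2l //.
  have Y0' a : sized m.+1 a -> ~ (sized m.+1 (k a) /\ h (k a) = a) -> `|Y a| = 0.
    by move=> sa ka; rewrite Y0 // normr0.
  rewrite -(fset_pullP Y0' BD).
  have pullD := @fset_pull_sub _ _ (sized m.+1) h k B.
  rewrite big_seq (eq_bigr (fun a => `|X a|)) => [|a /pullD /Yh ->] //.
  rewrite -big_seq; apply: IHN => // a /imfsetP[b /=].
  rewrite !inE => /andP[/BN bN /andP[_ /eqP hb]] ->.
  by rewrite -hb in bN.
have [S XS'] := abs_bounded_has_sum bX.
have hX : abs_has_sum (sized m.+1) X S by split=> //; exists (M / (1 - `|q|)).
have hY : abs_has_sum (sized m.+1) Y S.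
  apply: (abs_has_sum_reindex hk Y0); apply: eq_abs_has_sum hX => a sa.
  by rewrite Yh.
have SE : S = v + q * S.
  apply: has_sum_unique XS' _; have [hL _] := abs_has_sum_lin q hV hY.
  by apply: eq_has_sum hL => a /XE ->.
suff -> : v / (1 - q) = S by [].
have q1' : 1 - q != 0.
  by rewrite subr_eq0; apply: contraTneq q1 => <-; rewrite normr1 ltxx.
by apply: (canLR (mulfK q1')); rewrite mulrBr mulr1 {1}SE mulrC addrK.
Qed.

(** * The basis functions *)

(** This is [binom(n, k) / binom(n + k, k)].  The subtraction takes place in the
    field, so that the product vanishes by itself for [k > n] and the identities
    below hold for all [k]. *)
Definition bin_ratio (K : numFieldType) (n k : nat) : K :=
  \prod_(i < k) ((n%:R - i%:R) / (n + i).+1%:R).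

Lemma bin_ratio0 (K : numFieldType) n : bin_ratio K n 0 = 1.
Proof. by rewrite /bin_ratio big_ord0. Qed.

Lemma bin_ratioS (K : numFieldType) n k :
  (n%:R + k%:R + 1) * bin_ratio K n k.+1 = (n%:R - k%:R) * bin_ratio K n k.
Proof.
by rewrite /bin_ratio big_ord_recr /= -natrD natr1 mulrCA
  [X in _ * X = _]mulrC divfK ?pnatr_eq0 // mulrC.
Qed.

Lemma bin_ratio_gt (K : numFieldType) n k : (n < k)%N -> bin_ratio K n k = 0.
Proof.
by move=> nk; rewrite /bin_ratio (bigD1 (Ordinal nk)) //= subrr !mul0r.
Qed.

(** Passing from [n + 1] to [n] multiplies each basis function by a factor that
    depends on [k] only through [k^2]; this is what makes the recurrence for the
    generating functions diagonal. *)
Lemma bin_ratio_pred (K : numFieldType) n k :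
  n.+1%:R ^+ 2 * bin_ratio K n k = (n.+1%:R ^+ 2 - k%:R ^+ 2) * bin_ratio K n.+1 k.
Proof.
elim: k => [|k IHk]; first by rewrite !bin_ratio0 expr0n subr0.
have p0 : n.+1%:R + k%:R != 0 :> K by rewrite -natrD pnatr_eq0.
apply: (mulfI p0).
have e1 := bin_ratioS K n k; have e2 := bin_ratioS K n.+1 k.
have -> : (n.+1%:R + k%:R) * (n.+1%:R ^+ 2 * bin_ratio K n k.+1) =
  n.+1%:R ^+ 2 * ((n%:R + k%:R + 1) * bin_ratio K n k.+1).
  by rewrite -natr1; ring.
rewrite e1 mulrCA IHk.
have -> : (n.+1%:R + k%:R) * ((n.+1%:R ^+ 2 - k.+1%:R ^+ 2) * bin_ratio K n.+1 k.+1)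
  = (n.+1%:R + k%:R) * (n.+1%:R - k.+1%:R) *
     ((n.+1%:R + k%:R + 1) * bin_ratio K n.+1 k.+1).
  by rewrite -!natr1; ring.
by rewrite e2 -!natr1; ring.
Qed.

Lemma bin_ratio_ge0 (K : numFieldType) n k : 0 <= bin_ratio K n k.
Proof.
have [kn|/bin_ratio_gt -> //] := leqP k n.
apply: prodr_ge0 => i _; rewrite divr_ge0 ?ler0n // subr_ge0 ler_nat.
exact: leq_trans (ltnW (ltn_ord i)) kn.
Qed.

Lemma bin_ratio_le1 (K : numFieldType) n k : bin_ratio K n k <= 1.
Proof.
have [kn|/bin_ratio_gt -> //] := leqP k n.
apply: prodr_ile1 => i _; have ik := leq_trans (ltnW (ltn_ord i)) kn.
rewrite divr_ge0 ?ler0n //= ?subr_ge0 ?ler_nat //.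
rewrite ler_pdivrMr ?ltr0n // mul1r -natrB // ler_nat.
by rewrite (leq_trans (leq_subr _ _)) // leqW // leq_addr.
Qed.

(** One step from [k] to [k + 1] loses at most [(2k + 1) / (n + 1)], and
    [1 + 3 + ... + (2k - 1) = k^2]. *)
Lemma bin_ratio_lower (K : numFieldType) n k :
  1 - k%:R ^+ 2 / n.+1%:R <= bin_ratio K n.+1 k.
Proof.
elim: k => [|k IHk]; first by rewrite expr0n mul0r subr0 bin_ratio0.
have [kn|nk] := leqP k.+1 n.+1; last first.
  rewrite bin_ratio_gt // subr_le0 ler_pdivlMr // mul1r -natrX ler_nat.
  by rewrite (leq_trans (ltnW nk)) // -mulnn leq_pmulr.
have d2 : k.*2.+1%:R = 2%:R * k%:R + 1 :> K by rewrite -natr1 -mul2n natrM.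
have d0 : 0 < n.+1%:R + k%:R + 1 :> K by rewrite -natrD natr1.
have -> : bin_ratio K n.+1 k.+1 =
  bin_ratio K n.+1 k - (k.*2.+1)%:R / (n.+1%:R + k%:R + 1) * bin_ratio K n.+1 k.
  apply: (mulfI (lt0r_neq0 d0)); rewrite bin_ratioS mulrBr mulrA.
  rewrite (mulrCA (_ + _ + _)) divff ?lt0r_neq0 // mulr1 -mulrBl; congr (_ * _).
  by rewrite d2; ring.
rewrite lerBrDr; apply: le_trans IHk.
rewrite -addrA lerD2l -lerBrDl opprK.
have -> : k.+1%:R ^+ 2 / n.+1%:R = (k.*2.+1)%:R / n.+1%:R + k%:R ^+ 2 / n.+1%:R :> K.
  by rewrite -mulrDl d2; congr (_ / _); rewrite -natr1; ring.
rewrite [X in _ <= X]addrC addrK.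
apply: (@le_trans _ _ (k.*2.+1%:R / (n.+1%:R + k%:R + 1))).
  by rewrite ler_piMr ?bin_ratio_le1 // divr_ge0 ?ler0n // ltW.
rewrite ler_wpM2l ?ler0n // lef_pV2 ?posrE ?ltr0n //.
by rewrite -addrA lerDl addr_ge0 ?ler0n.
Qed.

Lemma bin_ratio_tends_to1 (K : archiNumFieldType) k :
  tends_to (fun n => bin_ratio K n k) 1.
Proof.
move=> e e0.
have x0 : 0 <= k%:R ^+ 2 / e by rewrite divr_ge0 ?exprn_ge0 ?ler0n // ltW.
have := archi_boundP x0; set N := Num.bound _ => hN.
exists N.+1 => -[//|n]; rewrite ltnS => Nn.
rewrite distrC ger0_norm ?subr_ge0 ?bin_ratio_le1 // ltrBlDr -ltrBlDl.
apply: lt_le_trans (bin_ratio_lower K n k); rewrite ltrD2l ltrN2.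
rewrite ltr_pdivrMr ?ltr0n // mulrC -ltr_pdivrMr //.
by apply: lt_le_trans hN _; rewrite ler_nat leqW.
Qed.

(** * Multiplying and dividing expansions by n *)

Definition psum (K : numFieldType) (v : nat -> K) (n : nat) : K :=
  \sum_(1 <= k < n.+1) v k.

Lemma psum0 (K : numFieldType) (v : nat -> K) : psum v 0 = 0.
Proof. by rewrite /psum big_geq. Qed.

Lemma psumS (K : numFieldType) (v : nat -> K) n :
  psum v n.+1 = psum v n + v n.+1.
Proof. by rewrite /psum big_nat_recr. Qed.

Lemma eq_psum (K : numFieldType) (v w : nat -> K) n :
  (forall k, (0 < k <= n)%N -> v k = w k) -> psum v n = psum w n.
Proof. by move=> vw; apply: eq_big_nat => k /andP[k0 kn]; rewrite vw ?k0. Qed.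

(** This is [sum_(1 <= k <= l) 2^(Delta l k) v k], see [psum_Delta]: all terms are
    counted twice except the last one. *)
Definition Delta_sum (K : numFieldType) (v : nat -> K) (l : nat) : K :=
  psum v l + psum v l.-1.

(** Summation by parts against
    [n (c_n(k) - c_n(k+1)) = k c_n(k) + (k+1) c_n(k+1)].  At [N = n] the boundary
    term disappears and the identity expands [n * sum_k c_n(k) v_k]. *)
Lemma psum_mul_Delta_sum (K : numFieldType) (v : nat -> K) n N :
  psum (fun l => bin_ratio K n l * (l%:R * Delta_sum v l)) N =
  n%:R * psum (fun k => bin_ratio K n k * v k) N -
  (n%:R - N%:R) * bin_ratio K n N * psum v N.
Proof.
elim: N => [|N IHN]; first by rewrite !psum0 !mulr0 subrr.
rewrite psumS IHN -bin_ratioS /Delta_sum /= !psumS -natr1; ring.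
Qed.

(** The same summation by parts with alternating signs, where the roles of the
    two sides are exchanged: at [N = n] it expands the quotient by [n]. *)
Lemma psum_sign_Delta_sum (K : numFieldType) (v : nat -> K) n N :
  psum (fun k => bin_ratio K n k * (k%:R * (-1) ^+ k) * v k) N =
  n%:R * psum (fun l => bin_ratio K n l * ((-1) ^+ l * Delta_sum v l)) N -
  (-1) ^+ N * ((n%:R - N%:R) * bin_ratio K n N) * psum v N.
Proof.
elim: N => [|N IHN]; first by rewrite !psum0 !mulr0 subrr.
rewrite psumS IHN -bin_ratioS /Delta_sum /= !psumS -natr1 exprS; ring.
Qed.

(** At [N = n] this is the expansion of the constant 1, that is
    [sum_(-n <= k <= n) (-1)^k binom(2n, n + k) = 0]. *)
Lemma psum_sign_bin_ratio (K : numFieldType) n N :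
  n%:R * (1 + 2%:R * psum (fun k => bin_ratio K n k * (-1) ^+ k) N) =
  (-1) ^+ N * ((n%:R - N%:R) * bin_ratio K n N).
Proof.
elim: N => [|N IHN]; first by rewrite psum0 bin_ratio0; ring.
rewrite psumS (mulrDr 2%:R) addrA mulrDr IHN -bin_ratioS -natr1 exprS; ring.
Qed.

(** * Expansions of truncated generating functions *)

(** The flag [b] tells whether an odd number of separators is still to be put in
    front: in that case the coefficients contain the factor [k (-1)^k], which the next
    separator 3 removes. *)
Definition bin_rep (K : numFieldType) (b : bool) (v U : nat -> K) : Prop :=
  forall n, (0 < n)%N ->
    U n = psum (fun k => bin_ratio K n k * (k%:R * (-1) ^+ k) ^+ b * v k) n.

Definition separator (b : bool) : nat := if b then 1 else 3.

(** The effect on a truncated generating function of putting a block of twos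
    with variable [z], followed by the separator [e], in front of the strings
    counted by [U]. *)
Fixpoint gf_step (K : numFieldType) (e : nat) (z : K) (U : nat -> K) (x0 : K)
    (n : nat) : K :=
  if n is m.+1 then (gf_step e z U x0 m + U n / n%:R ^+ e) / (1 - z ^+ 2 / n%:R ^+ 2)
  else x0.

Definition off_poles (K : numFieldType) (z : K) : Prop :=
  forall k, (0 < k)%N -> k%:R ^+ 2 - z ^+ 2 != 0.

(** Multiplied by [n^2], the recurrence multiplies the coefficient at [k] of the
    previous value by [n^2 - k^2] and adds [w_k]; the ansatz works because
    [(n^2 - k^2) / (k^2 - z^2) + 1 = (n^2 - z^2) / (k^2 - z^2)]. *)
Lemma gf_step_solve (K : numFieldType) e (z : K) (U w : nat -> K) :
  off_poles z ->
  (forall n, (0 < n)%N -> n%:R ^+ 2 * (U n / n%:R ^+ e) =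
     psum (fun k => bin_ratio K n k * w k) n) ->
  forall n, gf_step e z U 0 n =
     psum (fun k => bin_ratio K n k * (w k / (k%:R ^+ 2 - z ^+ 2))) n.
Proof.
move=> zk Uw; elim=> [|n IHn]; first by rewrite psum0.
have n0 : n.+1%:R != 0 :> K by rewrite pnatr_eq0.
have nz := zk n.+1 isT.
rewrite [LHS]/=.
have -> x : x / (1 - z ^+ 2 / n.+1%:R ^+ 2) =
    n.+1%:R ^+ 2 * x / (n.+1%:R ^+ 2 - z ^+ 2).
  by move: n.+1%:R n0 nz => N N0 Nz; field; rewrite N0 Nz.
apply: (canLR (mulfK nz)).
rewrite mulrDr Uw // IHn /psum mulr_sumr mulr_suml.
have -> : \sum_(1 <= k < n.+1)
    n.+1%:R ^+ 2 * (bin_ratio K n k * (w k / (k%:R ^+ 2 - z ^+ 2))) =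
  \sum_(1 <= k < n.+2) (n.+1%:R ^+ 2 - k%:R ^+ 2) * bin_ratio K n.+1 k *
     (w k / (k%:R ^+ 2 - z ^+ 2)).
  rewrite [RHS]big_nat_recr //= subrr !mul0r addr0.
  by apply: eq_bigr => k _; rewrite mulrA bin_ratio_pred.
rewrite -big_split /=; apply: eq_big_nat => k /andP[k0 _].
by field; exact: zk.
Qed.

(** The separator 1 (when [~~ b]) requires [n U_n], the separator 3 requires
    [U_n / n]; these are the two summations by parts. *)
Lemma bin_rep_step (K : numFieldType) b (z : K) (v U : nat -> K) :
  off_poles z -> bin_rep b v U ->
  bin_rep (~~ b) (fun k => (-1) ^+ k / (k%:R ^+ 2 - z ^+ 2) * Delta_sum v k)
    (gf_step (separator (~~ b)) z U 0).
Proof.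
move=> zk vU n n0.
have signK k : (-1) ^+ k * (-1) ^+ k = 1 :> K by rewrite -expr2 sqrr_sign.
case: b vU => vU /=.
- rewrite (gf_step_solve (w := fun k => (-1) ^+ k * Delta_sum v k)) //.
    by apply: eq_psum => k _; ring.
  move=> m m0; have m0' : m%:R != 0 :> K by rewrite pnatr_eq0 -lt0n.
  apply: (mulfI m0').
  have := psum_sign_Delta_sum v m m; rewrite subrr mul0r mulr0 mul0r subr0 => <-.
  by rewrite vU //=; field.
- rewrite (gf_step_solve (w := fun k => k%:R * Delta_sum v k)) //.
    apply: eq_psum => k _; rewrite expr1.
    move: (signK k); set s := (-1) ^+ k => ss.
    by rewrite -[LHS]mulr1 -ss; ring.
  move=> m m0; have m0' : m%:R != 0 :> K by rewrite pnatr_eq0 -lt0n.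
  have := psum_mul_Delta_sum v m m; rewrite subrr mul0r mul0r subr0 => ->.
  rewrite vU // (@eq_psum _ _ (fun k => bin_ratio K m k * v k)).
    by field.
  by move=> k _; rewrite expr0 mulr1.
Qed.

Lemma bin_rep_one (K : numFieldType) :
  bin_rep false (fun k => - 2%:R * (-1) ^+ k) (fun=> 1 : K).
Proof.
move=> n n0; have n0' : n%:R != 0 :> K by rewrite pnatr_eq0 -lt0n.
have /eqP := psum_sign_bin_ratio K n n; rewrite subrr mul0r mulr0 mulf_eq0.
rewrite (negbTE n0') /= addr_eq0 => /eqP oneE; rewrite [LHS]oneE -mulNr.
by rewrite /psum mulr_sumr; apply: eq_bigr => k _; ring.
Qed.

(** Subtracting 1 moves the initial value into the inhomogeneous term, so that
    [gf_step_solve] applies to the product [prod_(k <= n) (1 - z^2/k^2)^-1]. *)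
Lemma gf_step_one (K : numFieldType) e (z : K) n : off_poles z ->
  gf_step e z (fun=> 0) 1 n = 1 + gf_step 2 z (fun=> z ^+ 2) 0 n.
Proof.
move=> zk; elim: n => [|n IHn] /=; first by rewrite addr0.
rewrite IHn; have := zk n.+1 isT.
have : n.+1%:R != 0 :> K by rewrite pnatr_eq0.
by move: n.+1%:R => N N0 Nz; field; rewrite N0 Nz expf_neq0.
Qed.

Lemma bin_rep_twos (K : numFieldType) e (z : K) : off_poles z ->
  bin_rep false (fun k => - 2%:R * (-1) ^+ k * (k%:R ^+ 2 / (k%:R ^+ 2 - z ^+ 2)))
    (gf_step e z (fun=> 0) 1).
Proof.
move=> zk n n0; rewrite gf_step_one // [X in X + _ = _](bin_rep_one K n0).
rewrite (gf_step_solve (w := fun k => z ^+ 2 * (- 2%:R * (-1) ^+ k))) //.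
  rewrite /psum -big_split /=; apply: eq_big_nat => k /andP[k0 _].
  by rewrite expr0; field; exact: zk.
move=> m m0; have m0' : m%:R != 0 :> K by rewrite pnatr_eq0 -lt0n.
rewrite mulrC divfK ?expf_neq0 // -[LHS]mulr1 [X in _ * X = _](bin_rep_one K m0).
by rewrite /psum mulr_sumr; apply: eq_bigr => k _; rewrite expr0; ring.
Qed.

(** * Chains and truncated zeta star sums *)

Fixpoint chains (m p : nat) : seq (seq nat) :=
  if m is m'.+1 then
    flatten [seq [seq k :: c | c <- chains m' k] | k <- iota 1 p]
  else [:: [::]].

Lemma mem_chains m p c :
  (c \in chains m p) = [&& size c == m, path geq p c & all (leq 1) c].
Proof.
elim: m p c => [|m IHm] p c /=; first by rewrite inE; case: c.
apply/flatten_mapP/idP => [[k]|].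
  rewrite mem_iota add1n ltnS => /andP[k1 kp] /mapP[c' c'k ->] /=.
  by move: c'k; rewrite IHm eqSS kp k1 /= => /and3P[-> -> ->].
case: c => [//|k c] /= /and3P[sc /andP[kp pc] /andP[k1 ac]].
exists k; first by rewrite mem_iota add1n ltnS k1.
by apply: map_f; rewrite IHm -eqSS sc pc.
Qed.

Lemma chains_uniq m p : uniq (chains m p).
Proof.
elim: m p => [//|m IHm] p /=.
elim: p 1%N => [//|p IHp] i /=.
rewrite cat_uniq IHp andbT map_inj_uniq ?IHm; last by move=> x y [].
apply/hasPn => c /flatten_mapP[k]; rewrite mem_iota => /andP[ik _] /mapP[x _ ->].
by apply/negP => /mapP[y _ [ki _]]; rewrite ki ltnn in ik.
Qed.

Lemma chains_sum (K : numFieldType) m p (F : seq nat -> K) :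
  \sum_(c <- chains m.+1 p) F c =
  psum (fun k => \sum_(c <- chains m k) F (k :: c)) p.
Proof.
rewrite /= big_flatten big_map /psum /index_iota subSS subn0.
by apply: eq_bigr => k _; rewrite big_map.
Qed.

Definition decr_seqs (m : nat) : set (seq nat) :=
  [set c | size c = m /\ sorted geq c && all (leq 1) c].

Lemma chains_decr m p c : c \in chains m p -> decr_seqs m c.
Proof.
rewrite mem_chains => /and3P[/eqP sc pc ac]; split=> //.
by rewrite ac andbT; exact: path_sorted pc.
Qed.

Lemma decr_chains m c p : decr_seqs m c -> (head 0 c <= p)%N -> c \in chains m p.
Proof.
move=> [sc /andP[pc ac]] hp; rewrite mem_chains sc eqxx ac andbT /=.
by case: c hp pc {sc ac} => //= k c ->.
Qed.

Fixpoint trunc_zeta (K : numFieldType) (s : seq nat) (n : nat) : K :=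
  if s is e :: s' then psum (fun k => (k%:R ^+ e)^-1 * trunc_zeta K s' k) n else 1.

Lemma trunc_zetaS (K : numFieldType) e s n :
  trunc_zeta K (e :: s) n.+1 =
  trunc_zeta K (e :: s) n + trunc_zeta K s n.+1 / n.+1%:R ^+ e.
Proof. by rewrite /= psumS mulrC. Qed.

Lemma trunc_zeta_ge0 (K : numFieldType) s n : 0 <= trunc_zeta K s n.
Proof.
elim: s n => //= e s IHs n; apply: sumr_ge0 => k _.
by rewrite mulr_ge0 // invr_ge0 exprn_ge0.
Qed.

Lemma trunc_zeta_mono (K : numFieldType) s n p : (n <= p)%N ->
  trunc_zeta K s n <= trunc_zeta K s p.
Proof.
move=> /subnKC <-; elim: (p - n)%N => [|q IHq]; first by rewrite addn0.
apply: le_trans IHq _; rewrite addnS; case: s => // e s.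
by rewrite trunc_zetaS lerDl divr_ge0 ?trunc_zeta_ge0 ?exprn_ge0.
Qed.

Lemma trunc_zeta_rmorph (K L : numFieldType) (phi : {rmorphism K -> L}) s n :
  phi (trunc_zeta K s n) = trunc_zeta L s n.
Proof.
elim: s n => [|e s IHs] n /=; first exact: rmorph1.
rewrite /psum rmorph_sum; apply: eq_bigr => k _.
by rewrite rmorphM fmorphV rmorphXn rmorph_nat IHs.
Qed.

Lemma trunc_zeta_chains (K : numFieldType) s n :
  trunc_zeta K s n = \sum_(c <- chains (size s) n)
     \prod_(i < size s) ((nth 0%N c i)%:R ^+ nth 0%N s i)^-1.
Proof.
elim: s n => [|e s IHs] n; first by rewrite /= big_seq1 big_ord0.
rewrite [size _]/= chains_sum /=; apply: eq_bigr => k _.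
rewrite IHs mulr_sumr; apply: eq_bigr => c _.
by rewrite big_ord_recl /=.
Qed.

Section ZetaStar.
Context (R : realType) (s : seq nat).
Let F (t : (size s).-tuple nat) : R :=
  \prod_(i < size s) ((tnth t i)%:R ^+ nth 0%N s i)^-1.

Let tup (c : seq nat) : (size s).-tuple nat := insubd (nseq_tuple (size s) 0%N) c.

Let F0 t : 0 <= F t.
Proof. by apply: prodr_ge0 => i _; rewrite invr_ge0 exprn_ge0. Qed.

Let tchains n := [seq tup c | c <- chains (size s) n].

Let val_tup n c : c \in chains (size s) n -> val (tup c) = c.
Proof. by rewrite mem_chains => /and3P[sc _ _]; rewrite val_insubd sc. Qed.

Let tchains_uniq n : uniq (tchains n).
Proof.
rewrite map_inj_in_uniq ?chains_uniq // => x y /val_tup xE /val_tup yE xy.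
by rewrite -xE -yE xy.
Qed.

Let sum_tchains n : \sum_(t <- tchains n) F t = trunc_zeta R s n.
Proof.
rewrite big_map trunc_zeta_chains big_seq [RHS]big_seq; apply: eq_bigr => c cn.
by apply: eq_bigr => i _; rewrite (tnth_nth 0%N) (val_tup cn).
Qed.

Let tchains_decr n t : t \in tchains n -> decr_tuples (size s) t.
Proof.
move=> /mapP[c cn ->]; have [_ h] := chains_decr cn.
by rewrite /decr_tuples /= (val_tup cn).
Qed.

Let esum_le (M : R) : (forall n, trunc_zeta R s n <= M) ->
  (\esum_(t in decr_tuples (size s)) (F t)%:E <= M%:E)%E.
Proof.
move=> znM; apply: ge_ereal_sup => _ [X [finX XD] <-].
rewrite fsbig_finite //= sumEFin lee_fin.
set A := fset_set X.
pose n := \max_(t <- A) head 0%N (val t).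
apply: le_trans (znM n); rewrite -sum_tchains.
apply: sum_fset_le_seq => // t tA.
have Dt : decr_tuples (size s) t by apply: XD; move: tA; rewrite in_fset_set // inE.
apply/mapP; exists (val t).
  apply: decr_chains; first by split; [rewrite size_tuple|].
  exact: (@leq_bigmax_seq _ _ predT (fun t : (size s).-tuple nat => head 0%N (val t))).
by apply: val_inj; rewrite val_insubd size_tuple eqxx.
Qed.

Let esum_ge_trunc n : ((trunc_zeta R s n)%:E <=
  \esum_(t in decr_tuples (size s)) (F t)%:E)%E.
Proof.
apply: esum_ge; exists [set` tchains n].
  by split; [exact: finite_seq | move=> t /= /tchains_decr].
by rewrite -fsbig_seq // sumEFin sum_tchains.
Qed.

(** Every finite set of tuples consists of chains below some [n], so the sum over
    all tuples is the supremum of the truncated sums. *)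
Lemma trunc_zeta_tends_to (M : R) : (forall n, trunc_zeta R s n <= M) ->
  (forall n, trunc_zeta R s n <= zeta_star R s) /\
  tends_to (trunc_zeta R s) (zeta_star R s).
Proof.
move=> znM; have E1 := esum_le znM; have E0 := esum_ge_trunc 0.
have fE : \esum_(t in decr_tuples (size s)) (F t)%:E = (zeta_star R s)%:E.
  by rewrite /zeta_star fineK // fin_numElt (lt_le_trans _ E0) ?ltNyr //
     (le_lt_trans E1) ?ltry.
have le n : trunc_zeta R s n <= zeta_star R s by rewrite -lee_fin -fE.
split=> // e e0.
have [[N hN]|h] := pselect (exists N, zeta_star R s - e < trunc_zeta R s N).
  exists N => n Nn; rewrite ler0_norm ?subr_le0 // opprB ltrBlDl -ltrBlDr.
  exact: lt_le_trans hN (trunc_zeta_mono _ _ Nn).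
have : ((zeta_star R s)%:E <= (zeta_star R s - e)%:E)%E.
  rewrite -fE; apply: esum_le => n; rewrite leNgt; apply/negP => hn.
  by apply: h; exists n.
by rewrite lee_fin lerBrDr gerDl leNgt e0.
Qed.
End ZetaStar.

(** * The finite identity *)

(** The summand of the theorem for a chain preceded by the entry [p], without
    the extra factor at its last entry. *)
Fixpoint chain_weight (K : numFieldType) (p : nat) (zs : seq K) (c : seq nat) : K :=
  match zs, c with
  | z :: zs', k :: c' =>
    (-1) ^+ k * 2%:R ^+ Delta p k / (k%:R ^+ 2 - z ^+ 2) * chain_weight k zs' c'
  | _, _ => 1
  end.

Definition chain_sum (K : numFieldType) (h : nat -> K) (zs : seq K) (p : nat) : K :=
  \sum_(c <- chains (size zs) p) chain_weight p zs c * h (last p c).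

Lemma psum_Delta (K : numFieldType) (v : nat -> K) p :
  psum (fun k => 2%:R ^+ Delta p k * v k) p = Delta_sum v p.
Proof.
case: p => [|p]; first by rewrite /Delta_sum /= !psum0 addr0.
rewrite psumS /Delta_sum psumS /= /Delta eqxx expr0 mul1r.
have -> : psum (fun k => 2%:R ^+ Delta p.+1 k * v k) p = psum v p + psum v p.
  rewrite -[RHS]mulr2n -[RHS]mulr_natl /psum mulr_sumr.
  apply: eq_big_nat => k /andP[_ kp].
  by rewrite /Delta gtn_eqF.
ring.
Qed.

Lemma chain_sum_cons (K : numFieldType) (h : nat -> K) z (zs : seq K) p :
  chain_sum h (z :: zs) p =
  Delta_sum (fun k => (-1) ^+ k / (k%:R ^+ 2 - z ^+ 2) * chain_sum h zs k) p.
Proof.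
rewrite /chain_sum [size _]/= chains_sum -psum_Delta; apply: eq_bigr => k _.
rewrite mulr_sumr mulr_sumr; apply: eq_bigr => c _ /=.
ring.
Qed.

(** The sum over the chains that start at [k], where the entry preceding [k] is 0
    and therefore contributes the factor 2. *)
Definition chain_head (K : numFieldType) (h : nat -> K) (zs : seq K) (k : nat) : K :=
  (-1) ^+ k * 2%:R / (k%:R ^+ 2 - head 0 zs ^+ 2) * chain_sum h (behead zs) k.

Lemma eq_bin_rep (K : numFieldType) b (v w U : nat -> K) :
  (forall k, (0 < k)%N -> v k = w k) -> bin_rep b v U -> bin_rep b w U.
Proof.
move=> vw vU n n0; rewrite vU //; apply: eq_psum => k /andP[k0 _].
by rewrite vw.
Qed.

Lemma Delta_sumZ (K : numFieldType) (a : K) v p :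
  Delta_sum (fun k => a * v k) p = a * Delta_sum v p.
Proof. by rewrite /Delta_sum /psum -!mulr_sumr mulrDr. Qed.

Lemma bin_rep_chain_step (K : numFieldType) b (s : K) h z z' zs U :
  off_poles z ->
  bin_rep b (fun k => s * chain_head h (z' :: zs) k) U ->
  bin_rep (~~ b) (fun k => s * chain_head h (z :: z' :: zs) k)
     (gf_step (separator (~~ b)) z U 0).
Proof.
move=> zk hU; apply: eq_bin_rep (bin_rep_step zk hU) => k _.
rewrite /chain_head /= chain_sum_cons.
pose v k := (-1) ^+ k / (k%:R ^+ 2 - z' ^+ 2) * chain_sum h zs k.
rewrite -/v (_ : Delta_sum _ k = s * 2%:R * Delta_sum v k); first by ring.
rewrite -Delta_sumZ; congr Delta_sum; apply/funext => j; rewrite /v; ring.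
Qed.

(** Generating function of the truncated zeta star sums over the strings
    [word31 m b a], see [abs_has_sum_word_gf].  A list [zs] of length [m + 1]
    belongs to strings that end with a block of twos, one of length [m] to
    strings that end with a separator. *)
Fixpoint word_gf (K : numFieldType) (m : nat) (b : bool) (zs : seq K) : nat -> K :=
  match m, zs with
  | 0%N, z :: _ => gf_step 0 z (fun=> 0) 1
  | m'.+1, z :: zs' => gf_step (separator b) z (word_gf m' (~~ b) zs') 0
  | _, [::] => fun=> 1
  end.

Lemma bin_rep_word_gf_open (K : numFieldType) m (zs : seq K) :
  {in zs, forall z, off_poles z} -> size zs = m.+1 ->
  bin_rep (odd m) (fun k => -1 * chain_head (fun l => l%:R ^+ 2) zs k)
    (word_gf m (odd m) zs).
Proof.
elim: m zs => [|m IHm] [//|z zs] zk [sz].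
  move/size0nil: sz => ->; have z0 : off_poles z by apply: zk; rewrite mem_head.
  apply: eq_bin_rep (bin_rep_twos 0 z0) => k _.
  by rewrite /chain_head /chain_sum /= big_seq1 /=; ring.
case: zs sz zk => [//|z' zs] sz zk.
rewrite [word_gf _ _ _]/=; apply: bin_rep_chain_step.
  by apply: zk; rewrite mem_head.
by rewrite negbK; apply: IHm => // x xz; apply: zk; rewrite inE xz orbT.
Qed.

(** Here the first step can be carried out explicitly: for the coefficients
    [-2 (-1)^k] of the constant 1, [Delta_sum] equals 2 at every [k >= 1], so
    that the innermost summation of the general pattern disappears. *)
Lemma bin_rep_word_gf_closed (K : numFieldType) m (zs : seq K) :
  {in zs, forall z, off_poles z} -> size zs = m.+1 ->
  bin_rep (odd m.+1) (fun k => 1 * chain_head (fun=> 1) zs k)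
    (word_gf m.+1 (odd m.+1) zs).
Proof.
elim: m zs => [|m IHm] [//|z zs] zk [sz].
  move/size0nil: sz => ->; have z0 : off_poles z by apply: zk; rewrite mem_head.
  apply: eq_bin_rep (bin_rep_step z0 (bin_rep_one K)) => k k0.
  rewrite /chain_head /chain_sum /= big_seq1 /= Delta_sumZ.
  have -> : Delta_sum (fun k => (-1) ^+ k : K) k = -1.
    have P n : psum (fun k => (-1) ^+ k : K) n = - (odd n)%:R.
      elim: n => [|n IHn]; first by rewrite psum0 oppr0.
      by rewrite psumS IHn -signr_odd /=; case: (odd n) => /=; ring.
    by case: k k0 => // k _; rewrite /Delta_sum !P /=; case: (odd k) => /=; ring.
  ring.
case: zs sz zk => [//|z' zs] sz zk.
rewrite [word_gf _ _ _]/=; apply: bin_rep_chain_step.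
  by apply: zk; rewrite mem_head.
by rewrite negbK; apply: IHm => // x xz; apply: zk; rewrite inE xz orbT.
Qed.

(** * Generating functions as unconditional sums *)

(** [m] blocks with separators and one block without; the latter is empty if the
    list [a] has only [m] entries, which gives the strings ending with a
    separator. *)
Fixpoint word31 (m : nat) (b : bool) (a : seq nat) : seq nat :=
  nseq (head 0%N a) 2%N ++
  (if m is m'.+1 then separator b :: word31 m' (~~ b) (behead a) else [::]).

Fixpoint even_monomial (K : numFieldType) (zs : seq K) (a : seq nat) : K :=
  match zs, a with
  | z :: zs', n :: a' => z ^+ (2 * n) * even_monomial zs' a'
  | _, _ => 1
  end.

(** For fixed [n] the hypotheses on [X] describe the convolution with a geometric
    series of ratio [z^2 / n^2] in the first exponent. *)
Lemma abs_has_sum_step (R : realType) (m e : nat) (z x0 : R[i])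
    (X U : nat -> seq nat -> R[i]) (u : nat -> R[i]) : `|z| < 1 ->
  abs_has_sum (sized m.+1) (X 0%N) x0 ->
  (forall n, abs_has_sum (sized m) (U n.+1) (u n.+1)) ->
  (forall n a, size a = m ->
    X n.+1 (0%N :: a) = X n (0%N :: a) + U n.+1 a / n.+1%:R ^+ e) ->
  (forall n k a, size a = m -> X n.+1 (k.+1 :: a) =
    X n (k.+1 :: a) + z ^+ 2 / n.+1%:R ^+ 2 * X n.+1 (k :: a)) ->
  forall n, abs_has_sum (sized m.+1) (X n) (gf_step e z u x0 n).
Proof.
move=> z1 h0 hU X0 XS; elim=> [//|n IHn] /=.
pose W a := if a is 0%N :: a' then U n.+1 a' else 0.
have hW : abs_has_sum (sized m.+1) W (u n.+1).
  apply: (abs_has_sum_reindex (D' := sized m) (h := cons 0%N) (k := behead)).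
  - by move=> a; rewrite /sized /= => ->.
  - by case=> [|[|k] a] //= [sa] [].
  - exact: hU.
apply: (abs_has_sum_geom (V := fun a => X n a + (n.+1%:R ^+ e)^-1 * W a)).
- rewrite normrM normfV !normrX normr_nat.
  rewrite ltr_pdivrMr ?exprn_gt0 ?ltr0n // mul1r.
  apply: (@lt_le_trans _ _ 1); first by rewrite expr_lt1.
  by rewrite exprn_ege1 // ler1n.
- by move=> a sa; rewrite X0 // mulrC.
- by move=> k a sa; rewrite XS // mulr0 addr0.
- by rewrite [_ / n.+1%:R ^+ e]mulrC; exact: abs_has_sum_lin.
Qed.

Lemma abs_has_sum0 (K : numFieldType) (I : choiceType) (D : set I) (f : I -> K) :
  (forall i, D i -> f i = 0) -> abs_has_sum D f 0.
Proof.
move=> f0; have := @abs_has_sum_finite K I D [::] f isT.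
by rewrite big_nil; apply=> // i Di _; exact: f0.
Qed.

Lemma off_poles_lt1 (K : numFieldType) (z : K) : `|z| < 1 -> off_poles z.
Proof.
move=> z1 k k0; rewrite subr_eq0; apply/eqP => /(congr1 Num.norm) /eqP.
rewrite !normrX normr_nat eq_sym lt_eqF //.
apply: (@lt_le_trans _ _ 1); first by rewrite expr_lt1.
by rewrite exprn_ege1 // ler1n.
Qed.

Lemma trunc_zeta_word_step (K : numFieldType) (z : K) zs s n k :
  trunc_zeta K (2%N :: s) n.+1 * (z ^+ (2 * k.+1) * zs) =
  trunc_zeta K (2%N :: s) n * (z ^+ (2 * k.+1) * zs) +
  z ^+ 2 / n.+1%:R ^+ 2 * (trunc_zeta K s n.+1 * (z ^+ (2 * k) * zs)).
Proof. by rewrite trunc_zetaS mulnS exprD; ring. Qed.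

Lemma abs_has_sum_word_gf (R : realType) (m : nat) (b : bool) (zs : seq R[i]) :
  {in zs, forall z, `|z| < 1} -> (m <= size zs <= m.+1)%N -> forall n,
  abs_has_sum (sized (size zs))
    (fun a => trunc_zeta R[i] (word31 m b a) n * even_monomial zs a)
    (word_gf m b zs n).
Proof.
elim: m b zs => [|m IHm] b [|z zs] // z1 /andP[s1 s2] n.
- have := @abs_has_sum_finite R[i] _ (sized 0) [:: [::]]
    (fun a => trunc_zeta R[i] (word31 0 b a) n * even_monomial [::] a) isT.
  rewrite big_seq1 /= mulr1; apply.
    by move=> a /=; rewrite inE => /eqP ->.
  by move=> a /size0nil ->; rewrite inE eqxx.
- move: s2; rewrite ltnS leqn0 => /eqP/size0nil zs0; rewrite {zs}zs0 in z1 s1 *.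
  move: n; apply: (abs_has_sum_step (U := fun _ _ => 0)).
  + by apply: z1; rewrite mem_head.
  + have := @abs_has_sum_finite R[i] _ (sized 1) [:: [:: 0%N]]
      (fun a => trunc_zeta R[i] (word31 0 b a) 0 * even_monomial [:: z] a) isT.
    rewrite big_seq1 /= muln0 expr0 !mulr1; apply.
      by move=> a /=; rewrite inE => /eqP ->.
    move=> [//|[|k] a] [/size0nil ->]; first by rewrite inE eqxx.
    by rewrite /= psum0 mul0r.
  + by move=> n; exact: abs_has_sum0.
  + by move=> n a _ /=; rewrite mul0r addr0.
  + by move=> n k [|//] _; rewrite [LHS]trunc_zeta_word_step.
- move: n; apply: (abs_has_sum_step
    (U := fun n a => trunc_zeta R[i] (word31 m (~~ b) a) n * even_monomial zs a)).
  + by apply: z1; rewrite mem_head.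
  + by apply: abs_has_sum0 => -[|[|k] a] //= _; rewrite psum0 mul0r.
  + move=> n; apply: IHm => [x xz|]; first by apply: z1; rewrite inE xz orbT.
    by apply/andP; split.
  + move=> n a _; rewrite [word31 _ _ _]/= [even_monomial _ _]/= muln0 expr0
      mul1r trunc_zetaS.
    by rewrite mulrDl mulrAC.
  + by move=> n k a _; rewrite [LHS]trunc_zeta_word_step.
Qed.

(** * Absolute summability over chains *)

Definition abs_chain_sum (K : numFieldType) (h : nat -> K) (zs : seq K) (q p : nat) : K :=
  \sum_(c <- chains (size zs) p) `|chain_weight q zs c * h (last q c)|.

(** The sum over the first entry of a chain, with [2^Delta] replaced by its
    maximal value 2: a majorant whatever entry precedes the chain. *)
Definition head_bound (K : numFieldType) (h : nat -> K) (z : K) (zs : seq K)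
    (p : nat) : K :=
  psum (fun k => 2%:R / `|k%:R ^+ 2 - z ^+ 2| * abs_chain_sum h zs k k) p.

Lemma abs_chain_sum_cons_le (K : numFieldType) (h : nat -> K) z (zs : seq K) q p :
  abs_chain_sum h (z :: zs) q p <= head_bound h z zs p.
Proof.
rewrite /abs_chain_sum [size _]/= chains_sum; apply: ler_sum => k _.
rewrite mulr_sumr; apply: ler_sum => c _ /=.
rewrite -(mulrA (_ / _)) normrM ler_wpM2r // normrM normfV ler_wpM2r ?invr_ge0 //.
rewrite normrM normrX normrN1 expr1n mul1r normrX normr_nat /Delta.
by case: eqP => _; rewrite ?expr0 ?expr1 // ler1n.
Qed.

Lemma chain_sum_le (K : numFieldType) (h : nat -> K) (zs : seq K) k :
  `|chain_sum h zs k| <= abs_chain_sum h zs k k.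
Proof. exact: ler_norm_sum. Qed.

Lemma bin_rep_bound (K : numFieldType) (h : nat -> K) s z zs (U : nat -> K) n :
  `|s| = 1 -> (0 < n)%N ->
  bin_rep false (fun k => s * chain_head h (z :: zs) k) U ->
  `|U n| <= head_bound h z zs n.
Proof.
move=> s1 n0 ->//; apply: le_trans (ler_norm_sum _ _ _) _.
apply: ler_sum => k _; rewrite expr0 mulr1 !normrM s1 mul1r.
rewrite (ger0_norm (bin_ratio_ge0 _ _ _)) normfV normrX normrN1 expr1n mul1r
  normr_nat /=.
apply: le_trans (_ : 1 * (2%:R / `|k%:R ^+ 2 - z ^+ 2| * `|chain_sum h zs k|) <= _).
  by rewrite ler_wpM2r ?bin_ratio_le1 // mulr_ge0 // divr_ge0.
by rewrite mul1r ler_wpM2l ?divr_ge0 ?chain_sum_le.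
Qed.

Definition grows (K : numFieldType) (w phi : nat -> K) : Prop :=
  exists2 C, 0 <= C & forall k, (0 < k)%N -> w k <= C * phi k.

(** [|k^2 - z^2| >= (1 - |z|^2) k^2], so one summation turns the growth rate
    [phi(k)] into that of [sum_(k <= p) phi(k) / k^2]. *)
Lemma head_bound_grows (K : numFieldType) (h : nat -> K) z zs
    (phi psi : nat -> K) (B : K) :
  `|z| < 1 -> 0 <= B ->
  (forall p, (0 < p)%N -> psum (fun k => phi k / k%:R ^+ 2) p <= B * psi p) ->
  grows (fun k => abs_chain_sum h zs k k) phi -> grows (head_bound h z zs) psi.
Proof.
move=> z1 B0 hB [C C0 hC].
pose A := 2%:R / (1 - `|z| ^+ 2).
have z2 : 0 < 1 - `|z| ^+ 2 by rewrite subr_gt0 expr_lt1.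
have A0 : 0 <= A by rewrite divr_ge0 // ltW.
exists (A * C * B) => [|p p0]; first exact: mulr_ge0 (mulr_ge0 A0 C0) B0.
rewrite -(mulrA (A * C)); apply: le_trans _ (ler_wpM2l (mulr_ge0 A0 C0) (hB p p0)).
rewrite /head_bound /psum mulr_sumr big_nat_cond [leRHS]big_nat_cond.
apply: ler_sum => k /andP[/andP[k0 _] _].
have k2 : 0 < k%:R ^+ 2 :> K by rewrite exprn_gt0 // ltr0n.
have D0 : 0 < `|k%:R ^+ 2 - z ^+ 2|.
  by rewrite normr_gt0; exact: (off_poles_lt1 z1).
have le : 2%:R / `|k%:R ^+ 2 - z ^+ 2| <= A / k%:R ^+ 2.
  rewrite /A -mulrA ler_wpM2l // -invfM lef_pV2 ?posrE ?D0 ?(mulr_gt0 z2 k2) //.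
  apply: le_trans _ (lerB_dist _ _); rewrite !normrX normr_nat mulrBl mul1r.
  by rewrite lerD2l lerN2 ler_peMr ?exprn_ge0 // exprn_ege1 // ler1n.
apply: (@le_trans _ _ (2%:R / `|k%:R ^+ 2 - z ^+ 2| * (C * phi k))).
  by rewrite ler_wpM2l ?divr_ge0 ?hC.
have Cphi : 0 <= C * phi k by apply: le_trans (hC k k0); apply: sumr_ge0.
apply: le_trans (ler_wpM2r Cphi le) _.
by rewrite le_eqVlt; apply/orP; left; apply/eqP; ring.
Qed.

Definition harmonic (K : numFieldType) (p : nat) : K := psum (fun k => k%:R^-1) p.

Lemma harmonic_ge1 (K : numFieldType) p : (0 < p)%N -> 1 <= harmonic K p.
Proof.
case: p => // p _; rewrite /harmonic /psum big_nat_recl // invr1 lerDl.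
by apply: sumr_ge0 => k _; rewrite invr_ge0.
Qed.

(** With [H_p] the harmonic number, the sharper bound [3 - (H_p + 1) / p] holds:
    its increment from [p] to [p + 1] is [H_(p+1) / (p (p + 1))], which is at
    least [H_(p+1) / (p + 1)^2]. *)
Lemma psum_harmonic (K : numFieldType) p : (0 < p)%N ->
  psum (fun k => harmonic K k / k%:R ^+ 2) p <= 3%:R * 1.
Proof.
case: p => // p _; rewrite mulr1.
apply: (@le_trans _ _ (3%:R - (harmonic K p.+1 + 1) / p.+1%:R)); last first.
  by rewrite gerBl divr_ge0 // addr_ge0 // (le_trans ler01) ?harmonic_ge1.
elim: p => [|p IHp].
  by rewrite le_eqVlt /harmonic !psumS !psum0; apply/orP; left; apply/eqP; field.
rewrite psumS; apply: le_trans (lerD IHp (lexx _)) _.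
rewrite -addrA lerD2l addrC -lerBrDr opprK.
have HS : harmonic K p.+2 = harmonic K p.+1 + p.+2%:R^-1 by rewrite /harmonic psumS.
set H := harmonic K p.+2 in HS *.
have -> : harmonic K p.+1 = H - p.+2%:R^-1 by rewrite HS addrK.
have H0 : 0 <= H by rewrite (le_trans ler01) ?harmonic_ge1.
have p1 : p.+1%:R != 0 :> K by rewrite pnatr_eq0.
have p2 : p.+2%:R != 0 :> K by rewrite pnatr_eq0.
have E : p.+2%:R = p.+1%:R + 1 :> K by rewrite natr1.
rewrite -subr_ge0.
suff -> : - ((H + 1) / p.+2%:R) + (H - p.+2%:R^-1 + 1) / p.+1%:R - H / p.+2%:R ^+ 2
   = H / (p.+1%:R * p.+2%:R ^+ 2).
  by rewrite divr_ge0 // mulr_ge0 // exprn_ge0.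
move: p1 p2 E; move: p.+1%:R p.+2%:R => x y x0 y0 E.
have -> : x = y - 1 by rewrite E addrK.
field; rewrite y0 /=; rewrite E addrK in x0 *; exact: x0.
Qed.

(** * Passing to the limit *)

Lemma tends_to_real_complex (R : realType) (u : nat -> R) (l : R) :
  tends_to u l -> tends_to (fun n => (u n)%:C) l%:C.
Proof.
move=> ul e e0; have er : e = (complex.Re e)%:C by rewrite RRe_real // gtr0_real.
rewrite er in e0 *; rewrite ltcR in e0.
have [N uN] := ul _ e0; exists N => n /uN.
by rewrite -rmorphB norm_real_complex ltcR.
Qed.

Lemma tends_toMr (K : numFieldType) (u : nat -> K) (l c : K) :
  tends_to u l -> tends_to (fun n => u n * c) (l * c).
Proof.
move=> ul e e0; have c0 : 0 < 1 + `|c| by rewrite ltr_pwDl.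
have [N uN] := ul _ (divr_gt0 e0 c0); exists N => n /uN.
rewrite ltr_pdivlMr // -mulrBl normrM; apply: le_lt_trans.
by rewrite ler_wpM2l // lerDr.
Qed.

Lemma bin_ratio_tends_to1_complex (R : realType) k :
  tends_to (fun n => bin_ratio R[i] n k) 1.
Proof.
have h := tends_to_real_complex (@bin_ratio_tends_to1 R k).
move=> e /h[N hN]; exists N => n /hN; rewrite rmorph1; congr (`|_ - _| < _).
rewrite /bin_ratio rmorph_prod; apply: eq_bigr => i _.
by rewrite rmorphM rmorphB fmorphV !rmorph_nat.
Qed.

Lemma norm_even_monomial (K : numFieldType) (zs : seq K) a :
  `|even_monomial zs a| = even_monomial (map Num.norm zs) a.
Proof.
elim: zs a => [|z zs IHzs] [|n a] //=; rewrite ?normr1 //.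
by rewrite normrM normrX IHzs.
Qed.

Lemma abs_chain_sum_cons_grows (K : numFieldType) (h : nat -> K) z zs
    (phi psi : nat -> K) (B : K) :
  `|z| < 1 -> 0 <= B ->
  (forall p, (0 < p)%N -> psum (fun k => phi k / k%:R ^+ 2) p <= B * psi p) ->
  grows (fun k => abs_chain_sum h zs k k) phi ->
  grows (fun k => abs_chain_sum h (z :: zs) k k) psi.
Proof.
move=> z1 B0 hB /(head_bound_grows z1 B0 hB)[C C0 hC]; exists C => // k k0.
exact: le_trans (abs_chain_sum_cons_le _ _ _ _ _) (hC k k0).
Qed.

Lemma abs_chain_sum_cons_harmonic (K : numFieldType) (h : nat -> K) z zs :
  `|z| < 1 -> grows (fun k => abs_chain_sum h zs k k) (harmonic K) ->
  grows (fun k => abs_chain_sum h (z :: zs) k k) (harmonic K).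
Proof.
move=> z1 /(abs_chain_sum_cons_grows (psi := fun=> 1) z1 (ler0n K 3) (@psum_harmonic K)).
move=> [C C0 hC]; exists C => // k k0; apply: le_trans (hC k k0) _.
by rewrite ler_wpM2l ?harmonic_ge1.
Qed.

Lemma abs_chain_sum_closed (K : numFieldType) (zs : seq K) :
  {in zs, forall z, `|z| < 1} ->
  grows (fun k => abs_chain_sum (fun=> 1) zs k k) (harmonic K).
Proof.
elim: zs => [|z zs IHzs] z1.
  exists 1 => // k k0; rewrite /abs_chain_sum big_seq1 /= mulr1 normr1 mul1r.
  exact: harmonic_ge1.
apply: abs_chain_sum_cons_harmonic; first by apply: z1; rewrite mem_head.
by apply: IHzs => x xz; apply: z1; rewrite inE xz orbT.
Qed.

(** The factor [k^2] at the last entry costs two summations: the growth rates are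
    [k^2], [k], then harmonic. *)
Lemma abs_chain_sum_open (K : numFieldType) (zs : seq K) :
  {in zs, forall z, `|z| < 1} -> (1 < size zs)%N ->
  grows (fun k => abs_chain_sum (fun l => l%:R ^+ 2) zs k k) (harmonic K).
Proof.
elim: zs => [//|z zs IHzs] z1 sz.
have z0 : `|z| < 1 by apply: z1; rewrite mem_head.
have zs1 : {in zs, forall z, `|z| < 1}.
  by move=> x xz; apply: z1; rewrite inE xz orbT.
have [zs2|] := boolP (1 < size zs)%N; first exact/abs_chain_sum_cons_harmonic/IHzs.
case: zs sz zs1 {z1 IHzs} => [//|z' [|//]] _ zs1 _.
have z0' : `|z'| < 1 by apply: zs1; rewrite mem_head.
apply: (@abs_chain_sum_cons_grows _ _ _ _ (fun k => k%:R) _ 1) => // [p p0|].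
  rewrite mul1r /harmonic /psum big_nat_cond [leRHS]big_nat_cond.
  apply: ler_sum => k /andP[/andP[k0 _] _].
  by rewrite expr2 invfM mulrA divff ?mul1r // pnatr_eq0 -lt0n.
apply: (@abs_chain_sum_cons_grows _ _ _ _ (fun k => k%:R ^+ 2) _ 1) => // [p p0|].
  rewrite mul1r /psum big_nat_cond (eq_bigr (fun=> 1)) => [|k /andP[/andP[k0 _] _]].
    by rewrite -big_nat_cond big_const_nat iter_addr_0 subn1.
  by rewrite divff // expf_neq0 // pnatr_eq0 -lt0n.
exists 1 => // k k0; rewrite /abs_chain_sum big_seq1 /= !mul1r normrX normr_nat.
exact: lexx.
Qed.

Lemma head_bound_bounded (K : numFieldType) (h : nat -> K) z zs :
  `|z| < 1 -> grows (fun k => abs_chain_sum h zs k k) (harmonic K) ->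
  exists M, forall n, head_bound h z zs n <= M.
Proof.
move=> z1 /(head_bound_grows (psi := fun=> 1) z1 (ler0n K 3) (@psum_harmonic K)).
move=> [C C0 hC]; exists C => -[|n]; first by rewrite /head_bound psum0.
by rewrite (le_trans (hC _ _)) // mulr1.
Qed.

(** For nonnegative variables all terms of the generating function are
    nonnegative, so its value bounds every partial sum. *)
Lemma trunc_zeta_word31_bounded (R : realType) (m : nat) (zs : seq R[i]) (M : R[i]) :
  {in zs, forall z, `|z| < 1} -> (m <= size zs <= m.+1)%N ->
  (forall n, `|word_gf m false (map Num.norm zs) n.+1| <= M) ->
  forall (B : {fset seq nat}) n, [set` B] `<=` sized (size zs) ->
  \sum_(a <- B) trunc_zeta R[i] (word31 m false a) n *
    even_monomial (map Num.norm zs) a <= M.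
Proof.
move=> z1 sz gM B n BD.
have r1 : {in map Num.norm zs, forall z : R[i], `|z| < 1}.
  by move=> _ /mapP[z zz ->]; rewrite normr_id z1.
have r0 a : 0 <= even_monomial (map Num.norm zs) a by rewrite -norm_even_monomial.
have := @abs_has_sum_word_gf R m false _ r1; rewrite size_map => /(_ sz n.+1)[hs _].
apply: le_trans (gM n); apply: le_trans (has_sum_ge0_le _ hs BD); last first.
  by move=> a _; rewrite mulr_ge0 ?trunc_zeta_ge0.
by apply: ler_sum => a _; rewrite ler_wpM2r // trunc_zeta_mono.
Qed.

Lemma even_monomial_nseq_neq0 (K : numFieldType) (r : K) N a :
  r != 0 -> even_monomial (nseq N r) a != 0.
Proof.
move=> r0; elim: N a => [|N IHN] [|n a] //=; rewrite ?oner_eq0 //.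
by rewrite mulf_neq0 ?expf_neq0.
Qed.

(** Both sides are limits of the two sides of the finite identity.  The hypotheses
    [rep] and [gr] are required of all lists of the right length, because the
    proof uses the finite identity three times: for the given variables, for
    their norms (which yields a summable majorant), and for variables equal to
    1/2 (which shows that each single zeta star value is finite). *)
Lemma zeta_star_generating (R : realType) (h : nat -> R[i]) (s : R[i]) (m : nat)
    (z : R[i]) (zs : seq R[i]) :
  `|s| = 1 -> (m <= (size zs).+1 <= m.+1)%N ->
  {in z :: zs, forall x : R[i], `|x| < 1} ->
  (forall ys : seq R[i], {in ys, forall x, off_poles x} -> size ys = (size zs).+1 ->
     bin_rep false (fun k => s * chain_head h ys k) (word_gf m false ys)) ->
  (forall ys : seq R[i], {in ys, forall x, `|x| < 1} -> size ys = size zs ->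
     grows (fun k => abs_chain_sum h ys k k) (harmonic R[i])) ->
  exists S T : R[i],
  [/\ has_sum (sized (size zs).+1)
        (fun a => (zeta_star R (word31 m false a))%:C * even_monomial (z :: zs) a) S,
      has_sum (decr_seqs (size zs).+1)
        (fun c => chain_weight 0 (z :: zs) c * h (last 0%N c)) T
    & S = s * T].
Proof.
move=> s1 sz z1 rep gr.
have bnd (y : R[i]) (ys : seq R[i]) : {in y :: ys, forall x : R[i], `|x| < 1} ->
    size ys = size zs -> exists M, forall n, `|word_gf m false (y :: ys) n.+1| <= M.
  move=> y1 sy; have y0 : `|y| < 1 by apply: y1; rewrite mem_head.
  have [|M hM] := @head_bound_bounded _ h y ys y0.
    by apply: gr => // x xy; apply: y1; rewrite inE xy orbT.
  exists M => n; apply: le_trans (hM n.+1).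
  apply: (bin_rep_bound s1) => //; apply: rep; last by rewrite /= sy.
  by move=> x /y1; exact: off_poles_lt1.
have zb a : sized (size zs).+1 a ->
    (forall n, trunc_zeta R (word31 m false a) n <= zeta_star R (word31 m false a)) /\
    tends_to (trunc_zeta R (word31 m false a)) (zeta_star R (word31 m false a)).
  (* Any point strictly between 0 and 1 would do: the coefficient of a monomial
     is bounded once the generating function is, at a point without zero
     coordinates. *)
  move=> sa; pose r : R[i] := 2%:R^-1.
  have r0 : 0 < r by rewrite invr_gt0.
  have r1 : r < 1 by rewrite invf_lt1 // ltr1n.
  have [||M hM] := bnd r (nseq (size zs) r).
  - move=> x; rewrite inE mem_nseq => /orP[/eqP ->|/andP[_ /eqP ->]];
    by rewrite gtr0_norm.
  - by rewrite size_nseq.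
  have nr : map Num.norm (nseq (size zs).+1 r) = nseq (size zs).+1 r.
    by rewrite map_nseq gtr0_norm.
  have := @trunc_zeta_word31_bounded R m (nseq (size zs).+1 r) M; rewrite nr size_nseq.
  move=> /(_ _ sz hM [fset a]%fset) H.
  pose w := even_monomial (nseq (size zs).+1 r) a.
  have w0 : 0 < w.
    by rewrite lt_def /w even_monomial_nseq_neq0 ?gt_eqF // -nr -norm_even_monomial
      normr_ge0.
  apply: (@trunc_zeta_tends_to _ _ (complex.Re (M / w))) => n.
  have : trunc_zeta R[i] (word31 m false a) n <= M / w.
    rewrite ler_pdivlMr //; have := H _ n; rewrite big_seq_fset1; apply.
      move=> x; rewrite mem_nseq => /andP[_ /eqP ->]; by rewrite gtr0_norm.
    by move=> b /=; rewrite inE => /eqP ->.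
  by rewrite -(trunc_zeta_rmorph (real_complex R)) lecE /= => /andP[_].
have z1' : {in `|z| :: map Num.norm zs, forall x : R[i], `|x| < 1}.
  by move=> _ /(@mapP _ _ _ (z :: zs))[x xz ->]; rewrite normr_id z1.
have [M hM] := bnd _ _ z1' (size_map _ _).
pose zeta a : R[i] := (zeta_star R (word31 m false a))%:C.
pose rs := map Num.norm (z :: zs).
have znE a n : (trunc_zeta R (word31 m false a) n)%:C =
    trunc_zeta R[i] (word31 m false a) n.
  exact: (trunc_zeta_rmorph (real_complex R)).
have rs0 a : 0 <= even_monomial rs a by rewrite -norm_even_monomial.
have zeta_ge a n : sized (size zs).+1 a -> trunc_zeta R[i] (word31 m false a) n <= zeta a.
  by move=> sa; rewrite -znE lecR; exact: (zb a sa).1.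
have zeta0 a : sized (size zs).+1 a -> 0 <= zeta a.
  by move=> /(zeta_ge a 0%N); apply: le_trans; exact: trunc_zeta_ge0.
have zn_lim a c : sized (size zs).+1 a ->
    tends_to (fun n => trunc_zeta R[i] (word31 m false a) n * c) (zeta a * c).
  move=> sa; have := tends_toMr c (tends_to_real_complex (zb a sa).2).
  by under [fun n => _ * c]funext do rewrite znE.
have gM : abs_bounded (sized (size zs).+1) (fun a => zeta a * even_monomial rs a) (M + 1).
  move=> B BD.
  have [a aB|N hN] := @tends_to_seq _ _ B
    (fun n a => trunc_zeta R[i] (word31 m false a) n * even_monomial rs a)
    (fun a => zeta a * even_monomial rs a) _ 1 ltr01; first exact/zn_lim/BD.
  apply: le_trans _
    (lerD (trunc_zeta_word31_bounded z1 sz hM N BD) (ltW (hN N (leqnn N)))).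
  rewrite -big_split big_seq [leRHS]big_seq; apply: ler_sum => a /BD sa /=.
  have g0 := mulr_ge0 (zeta0 a sa) (rs0 a).
  have u0 := mulr_ge0 (trunc_zeta_ge0 R[i] (word31 m false a) N) (rs0 a).
  rewrite [leLHS]ger0_norm // distrC -lerBlDl.
  by apply: real_ler_norm; rewrite rpredB // ger0_real.
have [||||S [zS gS]] := @dominated_has_sum R _ (sized (size zs).+1)
    (fun n a => trunc_zeta R[i] (word31 m false a) n * even_monomial (z :: zs) a)
    (fun a => zeta a * even_monomial (z :: zs) a) _ (word_gf m false (z :: zs)) _ _ _ gM.
- move=> n a sa; rewrite normrM norm_even_monomial ler_wpM2r //
    ger0_norm ?trunc_zeta_ge0 //.
  exact: zeta_ge.
- by move=> a sa; rewrite normrM norm_even_monomial ger0_norm ?zeta0.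
- by move=> a sa; exact: zn_lim.
- by move=> n; have [] := @abs_has_sum_word_gf R m false (z :: zs) z1 sz n.
(* Right-hand side: the sum over all chains. *)
have [|M' hM'] := @head_bound_bounded _ h z zs (z1 z (mem_head _ _)).
  by apply: gr => // x xz; apply: z1; rewrite inE xz orbT.
pose t c := chain_weight 0 (z :: zs) c * h (last 0%N c).
have tM : abs_bounded (decr_seqs (size zs).+1) (fun c => `|t c|) M'.
  move=> B BD; pose p := \max_(c <- B) head 0%N c.
  apply: le_trans (hM' p); apply: le_trans (abs_chain_sum_cons_le _ _ _ 0 _).
  under eq_bigr do rewrite normr_id.
  apply: sum_fset_le_seq => // [|c cB]; first exact: chains_uniq.
  apply: decr_chains; first exact: BD.
  exact: (@leq_bigmax_seq _ _ predT (head 0%N)).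
have [||||T [tT AT]] := @dominated_has_sum R _ (decr_seqs (size zs).+1)
    (fun n c => bin_ratio R[i] n (head 0%N c) * t c) t _
    (fun n => psum (fun k => bin_ratio R[i] n k * chain_head h (z :: zs) k) n)
    _ _ _ tM.
- move=> n c _; rewrite normrM ger0_norm ?bin_ratio_ge0 //.
  by rewrite ler_piMl ?bin_ratio_le1.
- by [].
- move=> c _; rewrite -[X in tends_to _ X]mul1r.
  exact/tends_toMr/bin_ratio_tends_to1_complex.
- move=> n; rewrite (_ : psum _ n = \sum_(c <- chains (size zs).+1 n)
      bin_ratio R[i] n (head 0%N c) * t c).
    have [] // := @abs_has_sum_finite R[i] _ (decr_seqs (size zs).+1)
        (chains (size zs).+1 n)
        (fun c => bin_ratio R[i] n (head 0%N c) * t c) (chains_uniq _ _).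
      by move=> c /chains_decr.
    move=> c cD cn; rewrite bin_ratio_gt ?mul0r // ltnNge.
    by apply: contra cn; exact: decr_chains.
  rewrite chains_sum; apply: eq_big_nat => k /andP[k0 _].
  rewrite /chain_head /chain_sum /= !mulr_sumr; apply: eq_bigr => c _.
  by rewrite /t /= /Delta ltn_eqF // expr1 -!mulrA.
exists S, T; split=> //.
apply: tends_to_unique gS _ => e e0.
have [N hN] := tends_toMr s AT e0.
(* The finite identity holds for n >= 1 only. *)
exists (maxn N 1) => n; rewrite geq_max => /andP[/hN + n0].
rewrite (rep (z :: zs) _ _ n n0) //; last by move=> x /z1; exact: off_poles_lt1.
congr (`|_ - _| < _); last by rewrite mulrC.
rewrite /psum mulr_suml; apply: eq_bigr => k _.
by rewrite expr0; ring.
Qed.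

(** * From lists to tuples *)

Lemma chain_weight_prod (K : numFieldType) (zs : seq K) n p c :
  size zs = n -> size c = n ->
  chain_weight p zs c = \prod_(i < n)
    ((-1) ^+ nth 0%N c i * 2%:R ^+ Delta (nth 0%N (p :: c) i) (nth 0%N c i)
      / ((nth 0%N c i)%:R ^+ 2 - nth 0 zs i ^+ 2)).
Proof.
elim: zs n p c => [|z zs IHzs] [|n] p [|k c] //=; first by rewrite big_ord0.
by move=> [sz] [sc]; rewrite big_ord_recl /= (IHzs n).
Qed.

Lemma even_monomial_prod (K : numFieldType) (zs : seq K) n a :
  size zs = n -> size a = n ->
  even_monomial zs a = \prod_(i < n) nth 0 zs i ^+ (2 * nth 0%N a i).
Proof.
elim: zs n a => [|z zs IHzs] [|n] [|k a] //=; first by rewrite big_ord0.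
by move=> [sz] [sc]; rewrite big_ord_recl /= (IHzs n).
Qed.

Lemma word31_flatten n j a (F : nat -> nat) :
  (forall i, (i < n)%N -> F (j + i)%N = nth 0%N a i) ->
  flatten [seq rcons (nseq (F i) 2%N) (if odd i then 1%N else 3%N) | i <- iota j n]
    ++ nseq (nth 0%N a n) 2%N = word31 n (odd j) a.
Proof.
elim: n j a => [|n IHn] j a FE /=; first by rewrite cats0 nth0.
rewrite -cats1 -!catA /= -{1}[j]addn0 FE // nth0 -nth_behead.
congr (_ ++ _ :: _); apply: (IHn j.+1) => i ni.
by rewrite addSnnS FE // nth_behead.
Qed.

Lemma nth_codom_ord (T : Type) (x0 : T) n (z : 'I_n -> T) (i : 'I_n) :
  nth x0 (codom z) i = z i.
Proof. by rewrite (nth_map i) ?nth_ord_enum // size_enum_ord. Qed.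

Lemma has_sum_tuple (K : numFieldType) n (D' : set (seq nat))
    (D : set (n.-tuple nat)) (F : seq nat -> K) (f : n.-tuple nat -> K) (S : K) :
  (forall c, D' c -> size c = n) -> (forall t, D t <-> D' (val t)) ->
  (forall t, D t -> F (val t) = f t) ->
  has_sum D' F S -> has_sum D f S.
Proof.
move=> D's DD' Ff hF; pose h c : n.-tuple nat := insubd (nseq_tuple n 0%N) c.
have hK c : D' c -> val (h c) = c by move=> /D's sc; rewrite val_insubd sc eqxx.
apply: (eq_has_sum Ff).
apply: (has_sum_reindex (D' := D') (h := h) (k := val)).
- by move=> c D'c; rewrite DD' hK.
- move=> t /DD' Dt []; split=> //; apply: val_inj; exact: hK.
- by apply: eq_has_sum hF => c D'c; rewrite hK.
Qed.

Lemma zeta_star_generating_tuple (R : realType) (h : nat -> R[i]) (s : R[i])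
    (m n : nat) (z : 'I_n.+1 -> R[i]) :
  `|s| = 1 -> (m <= n.+1 <= m.+1)%N -> (forall j, `|z j| < 1) ->
  (forall ys : seq R[i], {in ys, forall x, off_poles x} -> size ys = n.+1 ->
     bin_rep false (fun k => s * chain_head h ys k) (word_gf m false ys)) ->
  (forall ys : seq R[i], {in ys, forall x : R[i], `|x| < 1} -> size ys = n ->
     grows (fun k => abs_chain_sum h ys k k) (harmonic R[i])) ->
  exists S T : R[i],
  [/\ has_sum [set: n.+1.-tuple nat]
        (fun a => (zeta_star R (word31 m false a))%:C
                  * \prod_(j < n.+1) z j ^+ (2 * tnth a j)) S,
      has_sum (decr_tuples n.+1) (fun k => h (tnth k ord_max) * alt_prod z k) T
    & S = s * T].
Proof.
move=> s1 mn z1 rep gr.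
have sz : size (codom z) = n.+1 by rewrite size_codom card_ord.
have znth i : nth 0 (codom z) (i : 'I_n.+1) = z i by exact: nth_codom_ord.
have zs1 : {in codom z, forall x : R[i], `|x| < 1} by move=> _ /codomP[j ->].
case: (codom z) sz znth zs1 => [//|y ys] [sy] znth y1.
rewrite -sy in mn rep gr.
have [S [T [hS hT ST]]] := zeta_star_generating s1 mn y1 rep gr.
rewrite sy in hS hT; exists S, T; split=> //.
- apply: has_sum_tuple hS => // [t|t _].
    by split=> // _; rewrite /sized /= size_tuple.
  rewrite (even_monomial_prod (n := n.+1)) ?size_tuple //= ?sy //; congr (_ * _).
  by apply: eq_bigr => i _; rewrite (znth i) (tnth_nth 0%N).
- apply: has_sum_tuple hT => [c []//|t|t _].
    rewrite /decr_seqs /= size_tuple; split=> [? //|[]//].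
  rewrite (chain_weight_prod (n := n.+1)) ?size_tuple //= ?sy // mulrC; congr (h _ * _).
    by rewrite (tnth_nth 0%N) (last_nth 0%N) size_tuple.
  by apply: eq_bigr => i _; rewrite (znth i) (tnth_nth 0%N).
Qed.

Theorem theorem1p3 (R : realType) (d : nat) (hd : (1 <= d)%N)
    (z : 'I_(2 * d).+1 -> R[i]) (hz : forall j, `|z j| < 1) :
  (exists S T : R[i],
    [/\ has_sum [set: (2 * d).+1.-tuple nat]
          (fun a =>
             (zeta_star R (blocks31 (2 * d) (nth 0%N a)
                           ++ nseq (tnth a ord_max) 2%N))%:C
             * \prod_(j < (2 * d).+1) z j ^+ (2 * tnth a j)) S,
        has_sum (decr_tuples (2 * d).+1)
          (fun k => (tnth k ord_max)%:R ^+ 2 * alt_prod z k) T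
      & S = - T])
  /\
  (* Here the variables are z_1, ..., z_{2d}: z_0 is dropped by [lift ord0]. *)
  (exists S T : R[i],
    [/\ has_sum [set: (2 * d).-tuple nat]
          (fun a =>
             (zeta_star R (blocks31 (2 * d) (nth 0%N a)))%:C
             * \prod_(j < 2 * d) z (lift ord0 j) ^+ (2 * tnth a j)) S,
        has_sum (decr_tuples (2 * d))
          (fun k => alt_prod (fun i => z (lift ord0 i)) k) T
      & S = T]).
Proof.
have N1 : (1 < 2 * d)%N by rewrite mul2n -addnn (leq_add hd hd).
have No : odd (2 * d) = false by rewrite oddM.
move: (2 * d)%N N1 No z hz => [//|n] n1 no z hz; split.
- have [|||||S [T [hS hT ST]]] := @zeta_star_generating_tuple R
    (fun l => l%:R ^+ 2) (-1) n.+1 n.+1 z.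
  + by rewrite normrN1.
  + by rewrite leqnSn leqnn.
  + exact: hz.
  + by move=> ys yk sy; have := bin_rep_word_gf_open yk sy; rewrite no.
  + by move=> ys y1 sy; apply: abs_chain_sum_open; rewrite ?sy.
  exists S, T; split=> //; last by rewrite ST mulN1r.
  apply: eq_has_sum hS => a _; congr ((zeta_star R _)%:C * _).
  by rewrite (tnth_nth 0%N) -(@word31_flatten n.+1 0 a (nth 0%N a)).
- have [|||||S [T [hS hT ST]]] := @zeta_star_generating_tuple R
    (fun=> 1) 1 n.+1 n (fun i => z (lift ord0 i)).
  + by rewrite normr1.
  + by rewrite leqnn leqnSn.
  + by move=> j; exact: hz.
  + by move=> ys yk sy; have := bin_rep_word_gf_closed yk sy; rewrite no.
  + by move=> ys y1 sy; exact: abs_chain_sum_closed.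
  exists S, T; split=> //; last by rewrite ST mul1r.
    apply: eq_has_sum hS => a _; congr ((zeta_star R _)%:C * _).
    rewrite -(@word31_flatten n.+1 0 a (nth 0%N a)) //.
    by rewrite [nth _ _ n.+1]nth_default ?size_tuple // cats0.
  by apply: eq_has_sum hT => k _; rewrite mul1r.
Qed.
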